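(* Let $\Gamma$ be a discrete group and let $\theta\in\mathrm{Aut}(\Gamma)$ be an automorphism of $\Gamma$. If $\Gamma$ has the Haagerup property, then the twisted wreath product $\Gamma\wr_{\mathbf{Q}_2}^{\theta}V$ (considered as a discrete group) has the Haagerup property.
   Context: A discrete group $G$ (not necessarily countable) has the Haagerup property if there is a net of positive definite functions $\phi_i:G\to\mathbf{C}$, each vanishing at infinity (for every $\varepsilon>0$ the set $\{g:|\phi_i(g)|\ge\varepsilon\}$ is finite), converging pointwise to $1$. Thompson's group $V$: a standard dyadic interval is an interval $[\frac{a}{2^n},\frac{a+1}{2^n})$ with $n\ge 0$, $0\le a\le 2^n-1$; a standard dyadic partition is a finite partition of $[0,1)$ into standard dyadic intervals. $V$ is the group of bijections $v$ of $[0,1)$ for which there exist two standard dyadic partitions $\{I_1,\dots,I_n\}$, $\{J_1,\dots,J_n\}$ of $[0,1)$ and a permutation $\pi$ such that $v$ restricts to the increasing affine bijection $I_i\to J_{\pi(i)}$ for every $i$. $\mathbf{Q}_2$ denotes the set of dyadic rationals in $[0,1)$; it is $V$-invariant. For $v\in V$ and $x\in\mathbf{Q}_2$, $v'(x)$ is the right-derivative of $v$ at $x$ (a power of $2$). $\bigoplus_{\mathbf{Q}_2}\Gamma$ is the group of finitely supported maps $a:\mathbf{Q}_2\to\Gamma$ with pointwise multiplication. $V$ acts on it by automorphisms via $$(v\cdot a)(x)=\theta^{\log_2(v'(v^{-1}x))}\big(a(v^{-1}x)\big),\qquad v\in V,\ a\in\bigoplus_{\mathbf{Q}_2}\Gamma,\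 x\in\mathbf{Q}_2,$$ and $\Gamma\wr_{\mathbf{Q}_2}^{\theta}V:=\big(\bigoplus_{\mathbf{Q}_2}\Gamma\big)\rtimes V$ is the associated semidirect product. *)

(* Defs.v *)
From HB Require Import structures.
From mathcomp Require Import all_boot all_order all_algebra.
From mathcomp Require Import fingroup perm finmap complex.
From mathcomp Require Import all_classical all_reals all_analysis.
From mathcomp Require Import ring lra.

Set Implicit Arguments.
Unset Strict Implicit.
Unset Printing Implicit Defensive.

Import Order.TTheory GRing.Theory Num.Theory.
Import numFieldNormedType.Exports.

Local Open Scope classical_set_scope.
Local Open Scope ring_scope.

(* A discrete group is a [groupType] from [mathcomp.boot.monoid] (possibly    *)
(* infinite, not necessarily countable), and C is [R[i]] for [R : realType].  *)
Section Haagerup.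
Variables (R : realType) (G : groupType).

(* In [R[i]], [0 <= z] means that z is real and nonnegative. *)
Definition positive_definite (phi : G -> R[i]) : Prop :=
  forall (n : nat) (g : 'I_n -> G) (c : 'I_n -> R[i]),
    0 <= \sum_(i < n) \sum_(j < n) (c i)^* * c j * phi ((g i)^-1 * g j)%g.

Definition vanishes_at_infinity (phi : G -> R[i]) : Prop :=
  forall e : R, 0 < e -> finite_set [set g | e%:C%C <= `|phi g|].

Definition directed (I : Type) (le : I -> I -> Prop) : Prop :=
  [/\ inhabited I,
      forall i, le i i,
      forall i j k, le i j -> le j k -> le i k &
      forall i j, exists2 k, le i k & le j k].

Definition net_cvg (I : Type) (le : I -> I -> Prop) (z : I -> R[i]) (l : R[i])
    : Prop :=
  forall e : R, 0 < e -> exists i0, forall i, le i0 i -> `|z i - l| < e%:C%C.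

Definition haagerup : Prop :=
  exists (I : Type) (le : I -> I -> Prop) (phi : I -> G -> R[i]),
    [/\ directed le,
        forall i, positive_definite (phi i),
        forall i, vanishes_at_infinity (phi i) &
        forall g, net_cvg le (fun i => phi i g) 1].

End Haagerup.

Section SemidirectProduct.
Local Open Scope group_scope.

Record group_action (N H : groupType) := GroupAction {
  act :> H -> N -> N;
  act1 : forall n, act 1 n = n;
  actM : forall g h n, act (g * h) n = act g (act h n);
  act_morph : forall g, {morph act g : n m / n * m} }.

Definition sdprod_type (N H : groupType) (f : group_action N H) : Type :=
  (N * H)%type.

Variables (N H : groupType) (f : group_action N H).
Local Notation T := (sdprod_type f).

HB.instance Definition _ := Choice.copy T (N * H)%type.

Definition sd_one : T := (1, 1).
Definition sd_mul (p q : T) : T := (p.1 * f p.2 q.1, p.2 * q.2).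
Definition sd_inv (p : T) : T := (f p.2^-1 p.1^-1, p.2^-1).

Fact act_one g : f g 1 = 1.
Proof.
have e : f g 1 * f g 1 = f g 1 * 1 by rewrite -act_morph !mulg1.
by move/mulgI: e.
Qed.

Fact sd_mulA : associative sd_mul.
Proof. by move=> p q r; rewrite /sd_mul /= act_morph actM !mulgA. Qed.

Fact sd_mul1 : left_id sd_one sd_mul.
Proof. by case=> n h; rewrite /sd_mul /= act1 !mul1g. Qed.

Fact sd_1mul : right_id sd_one sd_mul.
Proof. by case=> n h; rewrite /sd_mul /= act_one !mulg1. Qed.

Fact sd_mulV : left_inverse sd_one sd_inv sd_mul.
Proof. by case=> n h; rewrite /sd_mul /sd_inv /= -act_morph !mulVg act_one. Qed.

Fact sd_Vmul : right_inverse sd_one sd_inv sd_mul.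
Proof. by case=> n h; rewrite /sd_mul /sd_inv /= -actM !mulgV act1 mulgV. Qed.

HB.instance Definition _ :=
  isGroup.Build T sd_mulA sd_mul1 sd_1mul sd_mulV sd_Vmul.

End SemidirectProduct.

Section DirectSum.
Local Open Scope group_scope.
Local Open Scope fset_scope.

Definition dsum (X : choiceType) (G : groupType) : Type :=
  {fsfun X -> G with 1}.

Variables (X : choiceType) (G : groupType).
Local Notation T := (dsum X G).

HB.instance Definition _ := Choice.copy T {fsfun X -> G with 1}.

Definition dsum_fun (a : T) : X -> G := fun_of_fsfun a.
Coercion dsum_fun : dsum >-> Funclass.

Definition ds_one : T := [fsfun of _ => 1].
Definition ds_mul (a b : T) : T :=
  [fsfun x in finsupp a `|` finsupp b => a x * b x].
Definition ds_inv (a : T) : T := [fsfun x in finsupp a => (a x)^-1].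

Fact dsumP (a b : T) : (forall x, a x = b x) -> a = b.
Proof. by move=> e; apply/fsfunP. Qed.

Fact dsum_out (a : T) x : x \notin finsupp a -> a x = 1.
Proof. exact: fsfun_dflt. Qed.

Fact ds_oneE x : ds_one x = 1.
Proof. by rewrite /dsum_fun fsfunE. Qed.

Fact ds_mulE a b x : ds_mul a b x = a x * b x.
Proof.
rewrite {1}/dsum_fun fsfunE; case: ifP => //; rewrite in_fsetU => /negbT.
by rewrite negb_or => /andP[/dsum_out -> /dsum_out ->]; rewrite mulg1.
Qed.

Fact ds_invE a x : ds_inv a x = (a x)^-1.
Proof.
rewrite {1}/dsum_fun fsfunE; case: ifP => // /negbT /dsum_out ->.
by rewrite invg1.
Qed.

Fact ds_mulA : associative ds_mul.
Proof. by move=> a b c; apply: dsumP => x; rewrite !ds_mulE mulgA. Qed.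

Fact ds_mul1 : left_id ds_one ds_mul.
Proof. by move=> a; apply: dsumP => x; rewrite ds_mulE ds_oneE mul1g. Qed.

Fact ds_1mul : right_id ds_one ds_mul.
Proof. by move=> a; apply: dsumP => x; rewrite ds_mulE ds_oneE mulg1. Qed.

Fact ds_mulV : left_inverse ds_one ds_inv ds_mul.
Proof.
by move=> a; apply: dsumP => x; rewrite ds_mulE ds_invE ds_oneE mulVg.
Qed.

Fact ds_Vmul : right_inverse ds_one ds_inv ds_mul.
Proof.
by move=> a; apply: dsumP => x; rewrite ds_mulE ds_invE ds_oneE mulgV.
Qed.

HB.instance Definition _ :=
  isGroup.Build T ds_mulA ds_mul1 ds_1mul ds_mulV ds_Vmul.

End DirectSum.

Section Automorphism.
Variable (G : groupType).

Record group_aut := GroupAut {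
  aut_fun :> G -> G;
  aut_inv : G -> G;
  aut_morph : {morph aut_fun : x y / (x * y)%g};
  aut_funK : cancel aut_fun aut_inv;
  aut_invK : cancel aut_inv aut_fun }.

Definition aut_pow (theta : group_aut) (k : int) : G -> G :=
  match k with
  | Posz n => iter n theta
  | Negz n => iter n.+1 (aut_inv theta)
  end.

Variable theta : group_aut.

Fact aut_inv_morph : {morph aut_inv theta : x y / (x * y)%g}.
Proof.
move=> x y; rewrite -{1}(aut_invK theta x) -{1}(aut_invK theta y).
by rewrite -aut_morph aut_funK.
Qed.

Fact aut_pow_morph k : {morph aut_pow theta k : x y / (x * y)%g}.
Proof.
case: k => n x y; rewrite /aut_pow; first by elim: n => //= n ->; rewrite aut_morph.
by elim: n.+1 => //= m ->; rewrite aut_inv_morph.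
Qed.

Fact aut_pow1 k : aut_pow theta k 1%g = 1%g.
Proof.
have : (aut_pow theta k 1 * aut_pow theta k 1 = aut_pow theta k 1 * 1)%g.
  by rewrite -aut_pow_morph !mulg1.
by move/mulgI.
Qed.

Fact aut_powS k x : aut_pow theta (k + 1) x = theta (aut_pow theta k x).
Proof.
case: k => [n|[|n]] /=; first by rewrite addn1.
- by rewrite aut_invK.
- by rewrite subn1 /= aut_invK.
Qed.

Fact aut_powP k x : aut_pow theta (k - 1) x = aut_inv theta (aut_pow theta k x).
Proof. by rewrite -[in RHS](subrK 1 k) aut_powS aut_funK. Qed.

Fact aut_powD k l x :
  aut_pow theta (k + l) x = aut_pow theta k (aut_pow theta l x).
Proof.
elim/int_ind: k => [|n IH|n IH]; first by rewrite add0r.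
- by rewrite -addn1 PoszD -addrA (addrC 1) addrA !aut_powS IH.
- rewrite -addn1 PoszD opprD -addrA (addrC (- 1)) addrA aut_powP IH.
  by rewrite -aut_powP.
Qed.

End Automorphism.

Section Thompson.
Variable R : realType.

Definition I01 : Type := {x : R | 0 <= x < 1}.
HB.instance Definition _ := SubChoice.copy I01 {x : R | 0 <= x < 1}.

Implicit Types (A B : set I01) (x y : I01) (v w : I01 -> I01).

Definition std_dyadic_itv A : Prop := exists n a : nat, (a < 2 ^ n)%N /\
  A = [set x | a%:R / 2 ^+ n <= \val x < (a%:R + 1) / 2 ^+ n].

Definition std_dyadic_partition (n : nat) (I : 'I_n -> set I01) : Prop :=
  (forall i, std_dyadic_itv (I i)) /\ partition setT I setT.

Definition increasing_affine_bij A B v : Prop := set_bij A B v /\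
  exists2 cd : R * R, 0 < cd.1 & forall x, A x -> \val (v x) = cd.1 * \val x + cd.2.

Definition is_thompson v : Prop := bijective v /\
  exists (n : nat) (I J : 'I_n -> set I01) (s : 'S_n),
    [/\ std_dyadic_partition I, std_dyadic_partition J &
        forall i, increasing_affine_bij (I i) (J (s i)) v].

(* Indexed version of [std_dyadic_itv] and explicit formula for the affine    *)
(* bijection between two of them.                                             *)
Definition ditv (p : nat * nat) : set I01 :=
  [set x | p.2%:R / 2 ^+ p.1 <= \val x < (p.2%:R + 1) / 2 ^+ p.1].
Definition dok (p : nat * nat) : Prop := (p.2 < 2 ^ p.1)%N.

Fact pow2_gt0 n : 0 < 2 ^+ n :> R. Proof. by rewrite exprn_gt0. Qed.
Fact pow2_neq0 n : 2 ^+ n != 0 :> R. Proof. by rewrite gt_eqF ?pow2_gt0. Qed.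
Fact pow2_nat n : (2 ^ n)%:R = 2 ^+ n :> R. Proof. by rewrite natrX. Qed.
Hint Resolve pow2_gt0 pow2_neq0 : core.

Fact ditvE p x : ditv p x <-> p.2%:R <= \val x * 2 ^+ p.1 < p.2%:R + 1.
Proof. by rewrite /ditv /= ler_pdivrMr // ltr_pdivlMr. Qed.

Fact ditv_mk p (t : R) : dok p -> p.2%:R <= t * 2 ^+ p.1 < p.2%:R + 1 ->
  exists2 x : I01, \val x = t & ditv p x.
Proof.
move=> ok /andP[h1 h2].
have t01 : 0 <= t < 1.
  apply/andP; split.
    by rewrite -(pmulr_lge0 _ (pow2_gt0 p.1)) (le_trans _ h1).
  rewrite -(ltr_pM2r (pow2_gt0 p.1)) mul1r (lt_le_trans h2) //.
  by rewrite -pow2_nat natr1 ler_nat.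
by exists (exist _ t t01) => //; apply/ditvE; rewrite /= h1 h2.
Qed.

Definition daff (p q : nat * nat) (v : I01 -> I01) : Prop :=
  forall x, ditv p x ->
    \val (v x) = (q.2%:R + (\val x * 2 ^+ p.1 - p.2%:R)) / 2 ^+ q.1.

Fact daffE p q v x : daff p q v -> ditv p x ->
  \val (v x) * 2 ^+ q.1 - q.2%:R = \val x * 2 ^+ p.1 - p.2%:R.
Proof. by move=> h /h ->; rewrite mulfVK // addrC addKr. Qed.

Fact daff_img p q v x : daff p q v -> ditv p x -> ditv q (v x).
Proof.
move=> h px; apply/ditvE; have := daffE h px; move/ditvE: px => /andP[h1 h2] e.
by apply/andP; split; lra.
Qed.

Fact daff_of_affine p q v : dok p -> dok q ->
  increasing_affine_bij (ditv p) (ditv q) v -> daff p q v.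
Proof.
move=> okp okq [[vf _ vs] [[c d] /= c0 vE']].
have {vE'}vE x : ditv p x -> \val (v x) = c * \val x + d := vE' x.
set P := 2 ^+ p.1 : R; set Q := 2 ^+ q.1 : R.
have P0 : 0 < P := pow2_gt0 _. have Q0 : 0 < Q := pow2_gt0 _.
have Pn : P != 0 := pow2_neq0 _. have Qn : Q != 0 := pow2_neq0 _.
set a := p.2%:R : R; set b := q.2%:R : R.
have [xl xlE xlP] : exists2 x : I01, \val x = a / P & ditv p x.
  by apply: ditv_mk => //; rewrite -/P -/a mulfVK // lexx ltrDl ltr01.
have [yl ylE ylP] : exists2 x : I01, \val x = b / Q & ditv q x.
  by apply: ditv_mk => //; rewrite -/Q -/b mulfVK // lexx ltrDl ltr01.
have low : c * (a / P) + d = b / Q.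
  apply/eqP; rewrite eq_le; apply/andP; split; last first.
    have := vf _ xlP; rewrite /ditv /= -/Q -/b => /andP[+ _].
    by rewrite vE // xlE.
  have [z zP zE] := vs _ ylP; rewrite -ylE -zE vE // lerD2r ler_pM2l //.
  by move: zP; rewrite /ditv /= => /andP[].
have hi : c * ((a + 1) / P) + d = (b + 1) / Q.
  apply/eqP; rewrite eq_le; apply/andP; split; rewrite leNgt; apply/negP => lt.
    have [|x xE xP] := @ditv_mk p (((b + 1) / Q - d) / c) okp.
      rewrite -/P -/a; apply/andP; split.
        rewrite -ler_pdivrMr // ler_pdivlMr // mulrC lerBrDr low.
        by rewrite ler_pM2r ?invr_gt0 // lerDl ler01.
      by rewrite -ltr_pdivlMr // ltr_pdivrMr // [_ * c]mulrC ltrBlDr.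
    have := vf _ xP; rewrite /ditv /= -/Q -/b => /andP[_].
    by rewrite vE // xE mulrCA mulfV ?gt_eqF // mulr1 subrK ltxx.
  have [|y yE yP] := @ditv_mk q (c * ((a + 1) / P) + d) okq.
    rewrite -/Q -/b; apply/andP; split.
      rewrite -ler_pdivrMr // -low lerD2r ler_pM2l //.
      by rewrite ler_pM2r ?invr_gt0 // lerDl ler01.
    by rewrite -ltr_pdivlMr.
  have [z zP zE] := vs _ yP.
  have := yE; rewrite -zE vE // => /addIr /(mulfI (negbT (gt_eqF c0))) zE'.
  by move: zP; rewrite /ditv /= zE' ltxx andbF.
have cE : c = P / Q.
  have : c * ((a + 1) / P) - c * (a / P) = (b + 1) / Q - b / Q.
    by rewrite -hi -low; ring.
  have -> : c * ((a + 1) / P) - c * (a / P) = c / P by field.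
  have -> : (b + 1) / Q - b / Q = Q^-1 by field.
  by move=> e; rewrite -[c](mulfVK Pn) e mulrC.
have dE : d = (b - a) / Q.
  have -> : d = b / Q - c * (a / P) by rewrite -low; ring.
  by rewrite cE; field; rewrite !gt_eqF.
move=> x xP; rewrite vE // cE dE -/P -/Q -/a -/b.
by field; rewrite gt_eqF.
Qed.

Fact affine_of_daff p q v : injective v -> dok p -> dok q -> daff p q v ->
  increasing_affine_bij (ditv p) (ditv q) v.
Proof.
move=> vi okp okq h; split; last first.
  exists (2 ^+ p.1 / 2 ^+ q.1, (q.2%:R - p.2%:R) / 2 ^+ q.1) => /=.
    by rewrite divr_gt0.
  by move=> x /h ->; rewrite -[sval x]/(\val x); field.
split=> [x px|x y _ _ /vi //|y qy]; first exact: daff_img h px.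
set Q := 2 ^+ q.1 : R; set P := 2 ^+ p.1 : R.
have P0 : P != 0 := pow2_neq0 _. have Q0 : Q != 0 := pow2_neq0 _.
have e : (p.2%:R + (\val y * Q - q.2%:R)) / P * P - p.2%:R = \val y * Q - q.2%:R.
  by field.
have [|x xE px] := @ditv_mk p ((p.2%:R + (\val y * Q - q.2%:R)) / P) okp.
  move/ditvE: qy => /andP[]; rewrite -/Q -/P; move: e.
  by set u := _ / P * P; set t := \val y * Q; move=> e h1 h2; apply/andP; split; lra.
exists x => //; apply: val_inj; rewrite (h _ px) -/P -/Q xE e.
by rewrite addrCA subrr addr0 mulfK.
Qed.

(* Reindexing away the permutation and passing to an arbitrary finite index    *)
(* type.                                                                       *)
Definition dpart (T : finType) (I : T -> nat * nat) : Prop :=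
  [/\ forall i, dok (I i), forall x, exists i, ditv (I i) x &
      forall i j x, ditv (I i) x -> ditv (I j) x -> i = j].

Fact dok_inh p : dok p -> exists x, ditv p x.
Proof.
move=> ok; have [|x _ xp] := @ditv_mk p (p.2%:R / 2 ^+ p.1) ok; last by exists x.
by rewrite mulfVK // lexx ltrDl ltr01.
Qed.

Fact is_thompsonP v : is_thompson v <-> bijective v /\
  exists (T : finType) (I J : T -> nat * nat),
    [/\ dpart I, dpart J & forall i, daff (I i) (J i) v].
Proof.
split=> -[vb].
  move=> [n [I [J [s [[Id Ip] [Jd Jp] vIJ]]]]]; split=> //.
  have getp (K : 'I_n -> set I01) : (forall i, std_dyadic_itv (K i)) ->
      partition setT K setT ->
      exists2 K' : 'I_n -> nat * nat, dpart K' & forall i, K i = ditv (K' i).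
    move=> Kd [Kc Kt _].
    have /choice[K' K'P] : forall i, exists p, dok p /\ K i = ditv p.
      by move=> i; have [m [a [ok e]]] := Kd i; exists (m, a).
    exists K' => [|i]; last by case: (K'P i).
    split=> [i|x|i j x]; first by case: (K'P i).
      have : cover setT K x by rewrite Kc.
      by move=> [i _]; rewrite (K'P i).2; exists i.
    rewrite -(K'P i).2 -(K'P j).2 => xi xj.
    by apply: (Kt i j) => //; exists x.
  have [I' I'p I'E] := getp _ Id Ip; have [J' [Jo Jx Ji] J'E] := getp _ Jd Jp.
  exists 'I_n, I', (J' \o s); split=> //=.
    split=> [i|x|i j x /= xi xj]; first exact: Jo.
      by have [i xi] := Jx x; exists (s^-1 i)%g; rewrite /= permKV.
    by apply: (@perm_inj _ s); apply: Ji xi xj.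
  by move=> i; apply: daff_of_affine; rewrite -?I'E -?J'E //;
    case: I'p.
move=> [T [I [J [Ip Jp vIJ]]]]; split=> //.
have mk (K : T -> nat * nat) : dpart K ->
    std_dyadic_partition (fun i : 'I_#|T| => ditv (K (enum_val i))).
  move=> [Ko Kx Ki]; split=> [i|].
    by exists (K (enum_val i)).1, (K (enum_val i)).2; split=> //; apply: Ko.
  split.
  - rewrite -subTset => x _; have [i xi] := Kx x.
    by exists (enum_rank i) => //; rewrite enum_rankK.
  - by move=> i j _ _ [x [xi xj]]; apply: enum_val_inj; apply: Ki xi xj.
  - by move=> i _; have [x xi] := dok_inh (Ko (enum_val i)); exists x.
exists #|T|, (fun i => ditv (I (enum_val i))), (fun i => ditv (J (enum_val i))), 1%g.
split; [exact: mk|exact: mk|move=> i].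
rewrite perm1; apply: affine_of_daff => //; first exact: bij_inj.
  by case: Ip.
by case: Jp.
Qed.

Fact thompson_id : is_thompson id.
Proof.
apply/is_thompsonP; split; first by exists id.
exists unit, (fun=> (0, 0)%N), (fun=> (0, 0)%N).
have h : dpart (fun _ : unit => (0, 0)%N).
  split=> // [x|[] [] //]; exists tt; apply/ditvE => /=.
  by rewrite expr0 mulr1 add0r; exact: (valP x).
by split=> // i x _ /=; rewrite !expr0 subr0 add0r mulr1 divr1.
Qed.

Fact thompson_inv v w : cancel v w -> cancel w v ->
  is_thompson v -> is_thompson w.
Proof.
move=> vK wK /is_thompsonP[vb [T [I [J [Ip Jp vIJ]]]]]; apply/is_thompsonP.
split; first by exists v.
exists T, J, I; split=> // i y yJ.
have [j yj] : exists j, ditv (I j) (w y) by case: Ip.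
have jE : j = i.
  by case: Jp => _ _; apply; last exact: yJ; rewrite -(wK y); apply: daff_img yj.
by rewrite jE in yj; rewrite -{2}(wK y) (daffE (vIJ i) yj) addrC subrK mulfK.
Qed.

(* Subdivision: [dchild p (k, c)] is the [c]-th piece of length [2^-k] of [p].*)
Definition dchild (p kc : nat * nat) : nat * nat :=
  (p.1 + kc.1, p.2 * 2 ^ kc.1 + kc.2)%N.

Fact dchild_ok p k : dok p -> dok k -> dok (dchild p k).
Proof.
rewrite /dok /dchild /= expnD => hp hk.
by rewrite (leq_trans (n := p.2.+1 * 2 ^ k.1)) ?leq_mul2r ?hp ?orbT // mulSn addnC ltn_add2r.
Qed.

Fact dchildE p k x : ditv (dchild p k) x <->
  k.2%:R <= (\val x * 2 ^+ p.1 - p.2%:R) * 2 ^+ k.1 < k.2%:R + 1.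
Proof.
rewrite ditvE /dchild /= natrD natrM pow2_nat exprD mulrBl mulrA.
by rewrite lerBrDl ltrBlDl addrA.
Qed.

Fact dchild_sub p k x : dok k -> ditv (dchild p k) x -> ditv p x.
Proof.
move=> ok /dchildE/andP[h1 h2]; apply/ditvE.
set u := \val x * 2 ^+ p.1 in h1 h2 *.
have h3 : 0 <= u - p.2%:R by rewrite -(pmulr_lge0 _ (pow2_gt0 k.1)) (le_trans _ h1).
have h4 : u - p.2%:R < 1.
  rewrite -(ltr_pM2r (pow2_gt0 k.1)) mul1r (lt_le_trans h2) //.
  by rewrite -pow2_nat natr1 ler_nat.
by apply/andP; split; lra.
Qed.

Fact daff_child p q k v : dok k -> daff p q v -> daff (dchild p k) (dchild q k) v.
Proof.
move=> ok h x xc; have /daffE-/(_ _ _ h) e := dchild_sub ok xc.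
have -> : \val (v x) = (q.2%:R + (\val x * 2 ^+ p.1 - p.2%:R)) / 2 ^+ q.1.
  by apply: h; apply: dchild_sub xc.
rewrite /dchild /= !natrD !natrM !pow2_nat !exprD; field.
by rewrite !pow2_neq0.
Qed.

Fact daff_childV p q k v x : daff p q v -> ditv p x ->
  ditv (dchild q k) (v x) <-> ditv (dchild p k) x.
Proof. by move=> h px; rewrite !dchildE (daffE h px). Qed.

Fact dok0 : dok (0, 0)%N. Proof. by []. Qed.
Fact dchild0 p : dchild p (0, 0)%N = p.
Proof. by case: p => n a; rewrite /dchild /= !addn0 expn0 muln1. Qed.

Fact ditv_nested p q x : (p.1 <= q.1)%N -> ditv p x -> ditv q x ->
  exists2 k, dok k & q = dchild p k.
Proof.
move=> le /ditvE/andP[p1 p2] /ditvE/andP[q1 q2].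
have qE : q.1 = (p.1 + (q.1 - p.1))%N by rewrite subnKC.
set d := (q.1 - p.1)%N in qE.
move: q1 q2; rewrite qE exprD mulrA; set u := \val x * _ in p1 p2 * => q1 q2.
have h1 : (p.2 * 2 ^ d < q.2.+1)%N.
  rewrite -(ltr_nat R) natrM pow2_nat -(natr1 q.2).
  by apply: le_lt_trans q2; rewrite ler_pM2r.
have h2 : (q.2 < p.2.+1 * 2 ^ d)%N.
  rewrite -(ltr_nat R) natrM pow2_nat -(natr1 p.2).
  by apply: le_lt_trans q1 _; rewrite ltr_pM2r.
exists (d, q.2 - p.2 * 2 ^ d)%N.
  by rewrite /dok /= ltn_subLR // -mulSnr.
by rewrite /dchild /= subnKC // -qE -surjective_pairing.
Qed.

Fact ditv_common p q x : ditv p x -> ditv q x ->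
  exists kl : (nat * nat) * (nat * nat), [/\ dok kl.1, dok kl.2,
    dchild p kl.1 = dchild q kl.2 &
    forall y, ditv p y -> ditv q y -> ditv (dchild p kl.1) y].
Proof.
move=> px qx; have [le|/ltnW le] := leqP p.1 q.1.
  have [k ok e] := ditv_nested le px qx; exists (k, (0, 0)%N).
  by rewrite /= dchild0 -e; split.
have [k ok e] := ditv_nested le qx px; exists ((0, 0)%N, k).
by rewrite /= dchild0 -e; split.
Qed.

Fact thompson_comp v w : is_thompson v -> is_thompson w -> is_thompson (w \o v).
Proof.
move=> /is_thompsonP[vb [S [I [J [[Io Ix Ii] [Jo Jx Ji] vIJ]]]]].
move=> /is_thompsonP[wb [T [K [L [[Ko Kx Ki] [Lo Lx Li] wKL]]]]].
apply/is_thompsonP; split; first exact: bij_comp.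
pose meets (ij : S * T) := `[< exists x, ditv (J ij.1) x /\ ditv (K ij.2) x >].
have /choice[c cP] : forall ij : {ij : S * T | meets ij}, exists kl :
    (nat * nat) * (nat * nat), [/\ dok kl.1, dok kl.2,
    dchild (J (val ij).1) kl.1 = dchild (K (val ij).2) kl.2 &
    forall y, ditv (J (val ij).1) y -> ditv (K (val ij).2) y ->
      ditv (dchild (J (val ij).1) kl.1) y].
  by case=> ij /= /asboolP[x [xJ xK]]; apply: ditv_common xJ xK.
exists {ij : S * T | meets ij}, (fun ij => dchild (I (val ij).1) (c ij).1),
  (fun ij => dchild (L (val ij).2) (c ij).2).
have piece x i j (vx : ditv (I i) x) (wx : ditv (K j) (v x)) :
    exists ij : {ij : S * T | meets ij}, val ij = (i, j).
  have m : meets (i, j).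
    by apply/asboolP; exists (v x); split=> //; apply: daff_img vx.
  by exists (exist _ (i, j) m).
have memI ij x : ditv (dchild (I (val ij).1) (c ij).1) x ->
    ditv (I (val ij).1) x /\ ditv (K (val ij).2) (v x).
  have [ok1 ok2 e _] := cP ij; move=> h; have xI := dchild_sub ok1 h; split=> //.
  by apply: (dchild_sub ok2); rewrite -e; apply/(daff_childV _ (vIJ _) xI).
split.
- split=> [ij|x|ij ij' x /memI[h1 h2] /memI[h1' h2']].
  + by apply: dchild_ok; [exact: Io|case: (cP ij)].
  + have [i xi] := Ix x; have [j xj] := Kx (v x).
    have [ij ijE] := piece _ _ _ xi xj; exists ij.
    have [_ _ _ h] := cP ij; rewrite ijE /= in h *.
    apply/(daff_childV _ (vIJ i) xi); apply: h => //.
    exact: daff_img xi.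
  + apply: val_inj; case: (val ij) (val ij') h1 h2 h1' h2' => [i j] [i' j'] /=.
    by move=> h1 h2 h1' h2'; rewrite (Ii _ _ _ h1 h1') (Ki _ _ _ h2 h2').
- have inv_w y : exists x, w (v x) = y.
    have [v' _ vK] := vb; have [w' _ wK] := wb.
    by exists (v' (w' y)); rewrite vK wK.
  have memL ij x : ditv (dchild (L (val ij).2) (c ij).2) (w (v x)) ->
      ditv (I (val ij).1) x /\ ditv (K (val ij).2) (v x).
    have [ok1 ok2 e _] := cP ij; move=> h.
    have [j vj] := Kx (v x).
    have jE : j = (val ij).2.
      by apply: (Li _ _ (w (v x))); [apply: daff_img vj|apply: dchild_sub h].
    rewrite jE in vj; move/(daff_childV _ (wKL _) vj): h; rewrite -e => h.
    split=> //; have [i xi] := Ix x.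
    suff <- : i = (val ij).1 by [].
    by apply: (Ji _ _ (v x)); [apply: daff_img xi|apply: dchild_sub h].
  split=> [ij|y|ij ij' y].
  + by apply: dchild_ok; [exact: Lo|case: (cP ij)].
  + have [x <-] := inv_w y.
    have [i xi] := Ix x; have [j xj] := Kx (v x).
    have [ij ijE] := piece _ _ _ xi xj; exists ij.
    have [_ _ e h] := cP ij; rewrite ijE /= in e h *.
    apply/(daff_childV _ (wKL j) xj); rewrite -e; apply: h => //.
    exact: daff_img xi.
  + have [x <-] := inv_w y; move=> /memL[h1 h2] /memL[h1' h2'].
    apply: val_inj; case: (val ij) (val ij') h1 h2 h1' h2' => [i j] [i' j'] /=.
    by move=> h1 h2 h1' h2'; rewrite (Ii _ _ _ h1 h1') (Ki _ _ _ h2 h2').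
- move=> ij x h; have [xI xK] := memI _ _ h; have [ok1 ok2 e _] := cP ij.
  have vx : ditv (dchild (K (val ij).2) (c ij).2) (v x).
    by rewrite -e; apply/(daff_childV _ (vIJ _) xI).
  have e1 := daffE (daff_child ok1 (vIJ _)) h.
  rewrite e in e1.
  by rewrite /= (daff_child ok2 (wKL _) vx) e1.
Qed.

(* The group law is composition: [(v * w) x = v (w x)]. *)
Definition thompsonV : Type := {v : I01 -> I01 | `[< is_thompson v >]}.
HB.instance Definition _ := gen_eqMixin thompsonV.
HB.instance Definition _ := gen_choiceMixin thompsonV.

Definition thompson_fun (v : thompsonV) : I01 -> I01 := sval v.
Coercion thompson_fun : thompsonV >-> Funclass.

Fact thompsonVP (v : thompsonV) : is_thompson v.
Proof. exact/asboolP/(svalP v). Qed.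

Fact thompsonV_inj (v w : thompsonV) : v =1 w -> v = w.
Proof. by move=> e; apply: val_inj; apply/funext. Qed.

Definition mkV v (h : is_thompson v) : thompsonV := exist _ v (asboolT h).

Fact thompson_has_inv (v : thompsonV) :
  exists w : thompsonV, cancel v w /\ cancel w v.
Proof.
have [[w vK wK] _] := thompsonVP v.
by exists (mkV (thompson_inv vK wK (thompsonVP v))).
Qed.

Definition V_one : thompsonV := mkV thompson_id.
Definition V_mul (v w : thompsonV) : thompsonV :=
  mkV (thompson_comp (thompsonVP w) (thompsonVP v)).
Definition V_inv (v : thompsonV) : thompsonV := sval (cid (thompson_has_inv v)).

Fact V_invK (v : thompsonV) : cancel v (V_inv v).
Proof. by rewrite /V_inv; case: cid => w []. Qed.

Fact V_invVK (v : thompsonV) : cancel (V_inv v) v.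
Proof. by rewrite /V_inv; case: cid => w []. Qed.

Fact V_mulA : associative V_mul.
Proof. by move=> u v w; apply: thompsonV_inj. Qed.

Fact V_mul1 : left_id V_one V_mul.
Proof. by move=> v; apply: thompsonV_inj. Qed.

Fact V_1mul : right_id V_one V_mul.
Proof. by move=> v; apply: thompsonV_inj. Qed.

Fact V_mulV : left_inverse V_one V_inv V_mul.
Proof. by move=> v; apply: thompsonV_inj => x; apply: V_invK. Qed.

Fact V_Vmul : right_inverse V_one V_inv V_mul.
Proof. by move=> v; apply: thompsonV_inj => x; apply: V_invVK. Qed.

HB.instance Definition _ :=
  isGroup.Build thompsonV V_mulA V_mul1 V_1mul V_mulV V_Vmul.

Fact I01_zero_subproof : 0 <= (0 : R) < 1.
Proof. by rewrite lexx ltr01. Qed.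

(* [v] as a function on the real line; the values off [0, 1) are irrelevant. *)
Definition extend v (t : R) : R :=
  \val (v (insubd (exist _ 0 I01_zero_subproof : I01) t)).

Definition right_derivative v x : R :=
  lim ((extend v (\val x + h) - extend v (\val x)) / h @[h --> 0^'+]).

(* The exponent of [r] when [r] is an integral power of [2], and [0] otherwise.*)
Definition log2 (r : R) : int := xget 0 [set k : int | r = 2 ^ k].

Fact log2_exp k : log2 (2 ^ k) = k.
Proof.
rewrite /log2; case: xgetP => [l _ /= e|/(_ k) h]; last by case: h.
have /= := @ieexprIz R 2 (ltr0Sn _ _).
by rewrite (eqr_nat R 2 1) => /(_ isT); apply.
Qed.

Fact extend_val v x : extend v (\val x) = \val (v x).
Proof. by rewrite /extend valKd. Qed.

Fact right_derivativeE v x (s e : R) : 0 < e ->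
  (forall y, \val x <= \val y < \val x + e ->
     \val (v y) = \val (v x) + s * (\val y - \val x)) ->
  right_derivative v x = s.
Proof.
move=> e0 h; apply: cvg_lim => //; apply: cvg_near_cst.
have /andP[x0 x1] := valP x.
near=> t.
have t0 : 0 < t by near: t; exact: nbhs_right_gt.
have te : t < e by near: t; exact: nbhs_right_lt.
have t1 : t < 1 - \val x by near: t; apply: nbhs_right_lt; rewrite subr_gt0.
have yt : 0 <= \val x + t < 1 by apply/andP; split; lra.
pose y : I01 := exist (fun u => is_true (0 <= u < 1)) _ yt.
have yE : \val y = \val x + t by [].
rewrite extend_val -yE extend_val h yE; last by apply/andP; split; lra.
by field; rewrite gt_eqF.
Unshelve. all: by end_near.
Qed.

Fact thompson_germ v x : is_thompson v -> exists k : int,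
  exists2 e : R, 0 < e & forall y, \val x <= \val y < \val x + e ->
     \val (v y) = \val (v x) + 2 ^ k * (\val y - \val x).
Proof.
move=> /is_thompsonP[_ [T [I [J [[_ Ix _] _ vIJ]]]]].
have [i xi] := Ix x; exists ((I i).1%:Z - (J i).1%:Z).
exists (((I i).2%:R + 1) / 2 ^+ (I i).1 - \val x).
  by rewrite subr_gt0; move: xi; rewrite /ditv /= => /andP[].
move=> y; rewrite addrC subrK => /andP[y1 y2].
have yi : ditv (I i) y.
  by rewrite /ditv /= y2 andbT (le_trans _ y1) //; case/andP: xi.
rewrite (vIJ _ _ xi) (vIJ _ _ yi) expfzDr ?pnatr_eq0 // -exprnN -exprnP.
by field; rewrite pow2_neq0.
Qed.

Definition log2_deriv v x : int := log2 (right_derivative v x).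

Fact log2_derivE v x k e : 0 < e ->
  (forall y, \val x <= \val y < \val x + e ->
     \val (v y) = \val (v x) + 2 ^ k * (\val y - \val x)) ->
  log2_deriv v x = k.
Proof. by move=> e0 h; rewrite /log2_deriv (right_derivativeE e0 h) log2_exp. Qed.

Fact log2_deriv_id x : log2_deriv id x = 0.
Proof.
by apply: (@log2_derivE _ _ _ 1) => // y _; rewrite expr0z mul1r addrC subrK.
Qed.

Fact log2_deriv_comp v w x : is_thompson v -> is_thompson w ->
  log2_deriv (v \o w) x = log2_deriv v (w x) + log2_deriv w x.
Proof.
move=> vV wV; have [k [e e0 vE]] := thompson_germ (w x) vV.
have [l [d d0 wE]] := thompson_germ x wV.
rewrite (log2_derivE e0 vE) (log2_derivE d0 wE).
have p0 : 0 < 2 ^ l :> R by rewrite exprz_gt0.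
apply: (@log2_derivE _ _ _ (Num.min d (e / 2 ^ l))).
  by rewrite lt_min d0 divr_gt0.
move=> y /andP[y1 y2]; move: y2; rewrite -ltrBlDl lt_min ltr_pdivlMr // => /andP[y2 y3].
have wy : \val (w y) = \val (w x) + 2 ^ l * (\val y - \val x).
  by apply: wE; rewrite y1 -ltrBlDl.
have p1 : 0 <= \val y - \val x by rewrite subr_ge0.
rewrite /= vE wy.
  by rewrite expfzDr ?pnatr_eq0 // addrAC subrr add0r mulrA.
by rewrite lerDl mulr_ge0 ?(ltW p0) //= ltrD2l mulrC.
Qed.

Definition is_dyadic (t : R) : Prop :=
  exists (a : int) (n : nat), t = a%:~R / 2 ^+ n.

Definition Q2 : Type := {x : I01 | `[< is_dyadic (\val x) >]}.
HB.instance Definition _ := SubChoice.copy Q2 {x : I01 | `[< is_dyadic (\val x) >]}.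

Fact thompson_dyadic (v : thompsonV) x :
  is_dyadic (\val x) -> is_dyadic (\val (v x)).
Proof.
case/is_thompsonP: (thompsonVP v) => _ [T [I [J [[_ Ix _] _ vIJ]]]] [a [n e]].
have [i xi] := Ix x; rewrite (vIJ _ _ xi) e.
exists (((J i).2%:Z - (I i).2%:Z) * 2 ^+ n + a * 2 ^+ (I i).1), (n + (J i).1)%N.
rewrite rmorphD !rmorphM rmorphB !rmorphXn /= exprD; field.
by rewrite !pow2_neq0.
Qed.

Definition V_Q2 (v : thompsonV) (x : Q2) : Q2 :=
  exist _ (v (\val x)) (asboolT (thompson_dyadic v (asboolW (valP x)))).

Fact V_Q2_val (v : thompsonV) (x : Q2) : \val (V_Q2 v x) = v (\val x). Proof. by []. Qed.

Fact V_Q2_1 (x : Q2) : V_Q2 1%g x = x. Proof. exact: val_inj. Qed.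

Fact V_Q2_M (v w : thompsonV) (x : Q2) : V_Q2 (v * w)%g x = V_Q2 v (V_Q2 w x).
Proof. exact: val_inj. Qed.

Section Action.
Variables (G : groupType) (theta : group_aut G).
Local Notation B := (dsum Q2 G).

Definition twist (v : thompsonV) (a : B) : B :=
  [fsfun x in [fset V_Q2 v y | y in finsupp a]%fset =>
    aut_pow theta (log2_deriv v (\val (V_Q2 v^-1%g x))) (a (V_Q2 v^-1%g x))].

Fact twistE (v : thompsonV) (a : B) (x : Q2) : twist v a x =
  aut_pow theta (log2_deriv v (\val (V_Q2 v^-1%g x))) (a (V_Q2 v^-1%g x)).
Proof.
rewrite {1}/dsum_fun fsfunE; case: ifP => // /negP h.
rewrite [in RHS]dsum_out ?aut_pow1 //; apply/negP => hx; apply: h.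
by apply/imfsetP; exists (V_Q2 v^-1%g x) => //=; rewrite -V_Q2_M mulgV V_Q2_1.
Qed.

Fact twist1 a : twist 1%g a = a.
Proof.
apply: dsumP => x; rewrite twistE invg1 V_Q2_1.
by rewrite (log2_deriv_id (\val x)).
Qed.

Fact twistM (v w : thompsonV) (a : B) : twist (v * w)%g a = twist v (twist w a).
Proof.
apply: dsumP => x; rewrite !twistE -V_Q2_M -invgM -aut_powD; congr aut_pow.
rewrite (log2_deriv_comp _ (thompsonVP v) (thompsonVP w)); congr (_ + _).
by rewrite -V_Q2_val -V_Q2_M invgM mulgA mulgV mul1g.
Qed.

Fact twist_morph (v : thompsonV) : {morph twist v : a b / (a * b)%g}.
Proof.
by move=> a b; apply: dsumP => x; rewrite ds_mulE !twistE ds_mulE aut_pow_morph.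
Qed.

Definition twisted_action : group_action B thompsonV :=
  GroupAction twist1 twistM twist_morph.

Definition twisted_wreath : groupType := sdprod_type twisted_action.

End Action.

End Thompson.

(* Main.v *)
Require Import Defs.
From HB Require Import structures.
From mathcomp Require Import all_boot all_order all_algebra.
From mathcomp Require Import finmap complex.
From mathcomp Require Import all_classical all_reals all_analysis.
From mathcomp Require Import ring lra zify.

(* Let m(x) be the least n such that 2^n x is an integer. For v in V the integer *)
(* log2 v'(v^-1 x) + m(x) - m(v^-1 x) vanishes for all but finitely many dyadic  *)
(* x, so relabelling a(x) by theta^m(x) (a(x)) and recording this integer embeds *)
(* the twisted wreath product over Gamma into the untwisted one over             *)
(* L := Gamma x|_theta Z, which is Haagerup because Z is amenable.               *)
(* On the untwisted wreath product, for phi positive definite on L with          *)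
(* phi(1) = 1, use  (b, v) |-> lam^d(b, v) * prod_x phi(b(x)).  Here d is the    *)
(* length associated with the action on the images of standard dyadic intervals, *)
(* each remembering how it was mapped affinely and the labels off its left       *)
(* endpoint; d <= r leaves finitely many v and confines the support of b to a    *)
(* fixed finite set, so the product over x takes care of vanishing at infinity.  *)

Set Implicit Arguments.
Unset Strict Implicit.
Unset Printing Implicit Defensive.

Import Order.TTheory GRing.Theory Num.Theory Normc.
Import numFieldNormedType.Exports.

Local Open Scope classical_set_scope.
Local Open Scope ring_scope.
Local Open Scope sesquilinear_scope.

(** * Positive semidefinite kernels *)

Section PsdKernel.
Variables (C : numClosedFieldType).

(** The Haagerup property passes to subgroups ([haagerup_inj]), so it is enough to embed the twisted
    wreath product into a Haagerup group. The exponents log2 v' form a cocycle on the dyadic points,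
    and the coboundary of the depth m cancels it outside a finite set ([shift_finite]). Applying
    theta^m(x) to the label at x therefore turns the twist into a finitely supported label in
    [Zext theta] ([untwist_M], [untwist_inj]). That group is Haagerup, by averaging over long
    windows of the integers ([haagerup_Zext]). For the untwisted wreath product over L, each g
    changes the family of all placed standard dyadic intervals in finitely many members only
    ([placements_symdiff_finite]). Counting the changes gives a left-invariant d such that lam^d is
    positive definite, being a product of two-valued kernels ([psd_symdiff]). A misplaced interval
    has only misplaced ancestors, so an element with d <= r places all intervals of level at least r
    correctly ([place_dist_level]). This bounds both v and the support of b, and the factors
    phi(b(x)) bound the values of b ([place_dist_finite], [wreath_fun_van]). Letting lam and phi
    tend to 1 concludes ([haagerup_untwisted_wreath]). *)

Definition psd (n : nat) (K : 'I_n -> 'I_n -> C) : Prop :=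
  forall c : 'I_n -> C, 0 <= \sum_(i < n) \sum_(j < n) (c i)^* * c j * K i j.

(** The pulled-back form at c is the form of K at the sums of c over the fibres of s. As s may
    repeat indices, one-point and two-point tests follow. *)
Lemma psd_pull m n (s : 'I_m -> 'I_n) (K : 'I_n -> 'I_n -> C) :
  psd K -> psd (fun i j => K (s i) (s j)).
Proof.
move=> K0 c.
suff -> : \sum_(i < m) \sum_(j < m) (c i)^* * c j * K (s i) (s j) =
  \sum_(i < n) \sum_(j < n) (\sum_(k < m | s k == i) c k)^* *
     (\sum_(k < m | s k == j) c k) * K i j by exact: K0.
rewrite (partition_big s predT) //=; apply: eq_bigr => i _.
under eq_bigr => k /eqP ski do rewrite (partition_big s predT) //=.
rewrite exchange_big /=; apply: eq_bigr => j _.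
rewrite rmorph_sum !mulr_suml; apply: eq_bigr => k /eqP <-.
rewrite mulr_sumr mulr_suml; apply: eq_bigr => l /eqP <- //.
Qed.

Lemma psd_diag n (K : 'I_n -> 'I_n -> C) i : psd K -> 0 <= K i i.
Proof.
move=> /(psd_pull (fun _ : 'I_1 => i)) /(_ (fun=> 1)).
by rewrite !big_ord1 conjC1 !mul1r.
Qed.

Lemma psd_pair n (K : 'I_n -> 'I_n -> C) i j (a b : C) : psd K ->
  0 <= a^* * a * K i i + a^* * b * K i j + (b^* * a * K j i + b^* * b * K j j).
Proof.
move=> /(psd_pull (fun k : 'I_2 => if k == 0 then i else j)).
move=> /(_ (fun k => if k == 0 then a else b)).
by rewrite !big_ord_recl !big_ord0 /= !addr0.
Qed.

(** Polarization: the form is real at (1, 1) and at (1, ['i]), which fixes the sum and the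
    difference of K i j and K j i. *)
Lemma psd_herm n (K : 'I_n -> 'I_n -> C) i j : psd K -> K j i = (K i j)^*.
Proof.
move=> K0.
have ii : (K i i)^* = K i i by apply: conj_Creal; exact/ger0_real/psd_diag.
have jj : (K j j)^* = K j j by apply: conj_Creal; exact/ger0_real/psd_diag.
have := psd_pair i j 1 1 K0; rewrite !conjC1 !mul1r => /ger0_real/conj_Creal e1.
have := psd_pair i j 1 'i K0; rewrite !conjC1 !mul1r !mulr1 conjCi =>
  /ger0_real/conj_Creal e2.
move: e1 e2; rewrite !rmorphD !rmorphM !rmorphN /= !conjCi ii jj.
set x := K i j; set y := K j i; set u := x^*; set v := y^* => e1 e2.
have i0 : 'i != 0 :> C by apply: neq0Ci.
have h1 : u + v = x + y.
  apply: (addrI (K i i + K j j)).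
  have -> : K i i + K j j + (u + v) = K i i + u + (v + K j j) by ring.
  by rewrite e1; ring.
have h2 : 'i * (v - u) = 'i * (x - y).
  apply: (addrI (K i i + - 'i * 'i * K j j)).
  have -> : K i i + - 'i * 'i * K j j + 'i * (v - u) =
      K i i + - 'i * u + (- - 'i * v + - - 'i * - 'i * K j j).
    by ring.
  have -> : K i i + - 'i * 'i * K j j + 'i * (x - y) =
      K i i + 'i * x + (- 'i * y + - 'i * 'i * K j j) by ring.
  by rewrite -e2; ring.
move/(mulfI i0): h2 => h2.
have : y *+ 2 = u *+ 2.
  by transitivity ((x + y) - (x - y)); [ring|rewrite -h1 -h2; ring].
by move/eqP; rewrite eqrMn2r //= => /eqP.
Qed.

Lemma psd_gram n (K : 'I_n -> 'I_n -> C) : psd K ->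
  exists (d : 'I_n -> C) (P : 'I_n -> 'I_n -> C),
    (forall k, 0 <= d k) /\
    forall i j, K i j = \sum_(k < n) (P k i)^* * d k * P k j.
Proof.
move=> K0; pose A : 'M[C]_n := \matrix_(i, j) K i j.
have Ah : A \is hermsymmx.
  apply/is_hermitianmxP; rewrite expr0 scale1r; apply/matrixP => i j.
  by rewrite !mxE; apply: psd_herm.
have := orthomx_spectralP (hermitian_normalmx Ah).
set P := spectralmx A; set D := spectral_diag A => AE.
have PU : P \is unitarymx := spectral_unitarymx A.
rewrite invmx_unitary // in AE.
have KE i j : K i j = \sum_(k < n) (P k i)^* * D 0 k * P k j.
  have -> : K i j = A i j by rewrite mxE.
  rewrite AE mul_mx_diag mxE; apply: eq_bigr => k _.
  by rewrite !mxE.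
exists (D 0), P; split=> // k.
have DE : P *m A *m (P ^t* ) = diag_mx D.
  rewrite AE !mulmxA (unitarymxP PU) mul1mx -mulmxA.
  by rewrite (unitarymxP PU) mulmx1.
(* The k-th eigenvalue is the value of the form at the k-th eigenvector. *)
have := K0 (fun i => (P k i)^*).
have -> : D 0 k = (P *m A *m P ^t* ) k k by rewrite DE mxE eqxx mulr1n.
rewrite mxE exchange_big /=; congr (0 <= _); apply: eq_bigr => j _.
rewrite !mxE mulr_suml; apply: eq_bigr => i _.
by rewrite !mxE /= conjCK; ring.
Qed.

(** Schur product theorem: by [psd_gram], K is a nonnegative combination of rank-one kernels, and
    multiplying L by a rank-one kernel only rescales the test vector. *)
Lemma psd_mul n (K L : 'I_n -> 'I_n -> C) :
  psd K -> psd L -> psd (fun i j => K i j * L i j).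
Proof.
move=> /psd_gram[d [P [d0 KE]]] L0 c.
suff -> : \sum_(i < n) \sum_(j < n) (c i)^* * c j * (K i j * L i j) =
  \sum_(k < n) d k * \sum_(i < n) \sum_(j < n)
     (c i * P k i)^* * (c j * P k j) * L i j.
  by apply: sumr_ge0 => k _; apply: mulr_ge0.
under [RHS]eq_bigr => k _ do rewrite mulr_sumr.
rewrite [RHS]exchange_big /=; apply: eq_bigr => i _.
under [RHS]eq_bigr => k _ do rewrite mulr_sumr.
rewrite [RHS]exchange_big /=; apply: eq_bigr => j _.
rewrite KE mulr_suml mulr_sumr; apply: eq_bigr => k _.
by rewrite rmorphM; ring.
Qed.

Lemma psd_rank1 n (f : 'I_n -> C) : psd (fun i j => (f i)^* * f j).
Proof.
move=> c.
suff -> : \sum_(i < n) \sum_(j < n) (c i)^* * c j * ((f i)^* * f j) =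
  (\sum_(i < n) c i * f i)^* * (\sum_(i < n) c i * f i).
  by rewrite mulrC mul_conjC_ge0.
rewrite rmorph_sum mulr_suml; apply: eq_bigr => i _.
by rewrite mulr_sumr; apply: eq_bigr => j _; rewrite rmorphM; ring.
Qed.

Lemma psd1 n : psd (fun _ _ : 'I_n => 1).
Proof. by have := @psd_rank1 n (fun=> 1); rewrite conjC1 mulr1. Qed.

Lemma psd_prod n (E : Type) (s : seq E) (K : E -> 'I_n -> 'I_n -> C) :
  (forall e, psd (K e)) -> psd (fun i j => \prod_(e <- s) K e i j).
Proof.
move=> K0; elim: s => [|e s IH].
  by under eq_fun2 do rewrite big_nil; exact: psd1.
under eq_fun2 do rewrite big_cons.
exact: psd_mul.
Qed.

Lemma psd_add n (K L : 'I_n -> 'I_n -> C) :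
  psd K -> psd L -> psd (fun i j => K i j + L i j).
Proof.
move=> K0 L0 c.
under eq_bigr => i _ do (under eq_bigr => j _ do rewrite mulrDr;
  rewrite big_split /=).
by rewrite big_split /= addr_ge0.
Qed.

Lemma psd_sum n (E : Type) (s : seq E) (K : E -> 'I_n -> 'I_n -> C) :
  (forall e, psd (K e)) -> psd (fun i j => \sum_(e <- s) K e i j).
Proof.
move=> K0; elim: s => [|e s IH] c.
  by under eq_bigr => i _ do (under eq_bigr => j _ do rewrite big_nil mulr0;
    rewrite big1 //); rewrite big1.
by under eq_bigr => i _ do under eq_bigr => j _ do rewrite big_cons; apply: psd_add.
Qed.

Lemma psd_scale n (a : C) (K : 'I_n -> 'I_n -> C) :
  0 <= a -> psd K -> psd (fun i j => a * K i j).
Proof.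
move=> a0 K0 c.
under eq_bigr => i _ do (under eq_bigr => j _ do rewrite mulrCA;
  rewrite -mulr_sumr).
by rewrite -mulr_sumr mulr_ge0.
Qed.

Lemma psd_ext n (K L : 'I_n -> 'I_n -> C) : K =2 L -> psd K -> psd L.
Proof.
move=> e K0 c; have := K0 c; congr (0 <= _).
by apply: eq_bigr => i _; apply: eq_bigr => j _; rewrite e.
Qed.

Lemma psd_le1 n (K : 'I_n -> 'I_n -> C) i j :
  psd K -> K i i = 1 -> K j j = 1 -> `|K i j| <= 1.
Proof.
move=> K0 ii jj; have [->|Kn] := eqVneq (K i j) 0; first by rewrite normr0.
have n0 : `|K i j| != 0 by rewrite normr_eq0.
(* A unimodular u with u * K i j = - |K i j|; the form at (1, u) is then 2 - 2 |K i j|. *)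
pose u := - (K i j)^* / `|K i j|.
have := psd_pair i j 1 u K0.
rewrite ii jj (psd_herm i j K0) conjC1 !mul1r !mulr1.
have uu : u^* * u = 1.
  rewrite /u fmorph_div rmorphN /= conjCK conj_normC mulrACA mulrNN -normCK
    -invfM -expr2.
  by rewrite divff // expf_neq0.
have ux : u * K i j = - `|K i j|.
  by rewrite /u mulrAC mulNr [_^* * _]mulrC -normCK expr2 mulNr mulfK.
have ux' : u^* * (K i j)^* = - `|K i j|.
  by rewrite -rmorphM /= ux rmorphN /= conj_normC.
rewrite uu ux ux' => h.
have : `|K i j| *+ 2 <= 1 *+ 2.
  rewrite -subr_ge0 !mulr2n; move: h; congr (0 <= _); ring.
by rewrite lerMn2r.
Qed.

End PsdKernel.

(** * Approximation of 1 on finite sets *)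

Section Approximation.
Variables (R : realType).
Implicit Types (z : R[i]) (e : R).

Lemma norm_ltcE z e : (`|z| < e%:C%C) = (normc z < e).
Proof. exact: ltcR. Qed.

Lemma norm_gecE z e : (e%:C%C <= `|z|) = (e <= normc z).
Proof. exact: lecR. Qed.

Lemma norm_lecE z e : (`|z| <= e%:C%C) = (normc z <= e).
Proof. exact: lecR. Qed.

Lemma normc_real e : normc (e%:C%C : R[i]) = `|e|.
Proof. by rewrite /normc /= expr0n /= addr0 sqrtr_sqr. Qed.

Lemma ge0_complexP z : 0 <= z -> exists2 r : R, 0 <= r & z = r%:C%C.
Proof.
case: z => a b; rewrite lecE /= => /andP[/eqP -> a0]; by exists a.
Qed.

(** Net-free form of the property, with the normalization phi(1) = 1 that forces |phi| <= 1. *)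
Definition haagerup_approx (G : groupType) : Prop :=
  forall (F : seq G) (e : R), 0 < e -> exists phi : G -> R[i],
    [/\ positive_definite phi, vanishes_at_infinity phi, phi 1%g = 1 &
        {in F, forall g, normc (phi g - 1) < e}].

Variable G : groupType.
Implicit Types (phi : G -> R[i]).

Lemma positive_definite_psd phi : positive_definite phi <->
  forall n (g : 'I_n -> G), psd (fun i j => phi ((g i)^-1 * g j)%g).
Proof. by split=> h n g; apply: h. Qed.

Lemma positive_definite_ge0 phi : positive_definite phi -> 0 <= phi 1%g.
Proof.
move=> /positive_definite_psd /(_ 1%N (fun=> 1%g)) /(psd_diag ord0).
by rewrite invg1 mulg1.
Qed.

Lemma positive_definite_le1 phi g :
  positive_definite phi -> phi 1%g = 1 -> normc (phi g) <= 1.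
Proof.
move=> /positive_definite_psd h phi1.
have := h 2 (fun k => if k == ord0 then 1%g else g) =>
  /(@psd_le1 _ _ _ ord0 ord_max) /=.
by rewrite !invg1 !mul1g mulVg => /(_ phi1 phi1);
  rewrite -[X in _ <= X]/(1%:C%C) norm_lecE.
Qed.

Lemma haagerupP : haagerup R G <-> haagerup_approx G.
Proof.
split.
  move=> [I [le [phi [[[i0] lerefl letr ledir] pd van cvg]]]] F e e0.
  (* The bound 1/2 keeps r = phi_i(1) above 1/2, so after division by r the error stays below 2d / r
     < 4d <= e / 2. *)
  pose d := Num.min (1 / 2) (e / 8).
  have d0 : 0 < d by rewrite lt_min; apply/andP; split; lra.
  have [i iP] : exists i, {in 1%g :: F, forall g, normc (phi i g - 1) < d}.
    suff [i iP] : exists i, forall j, le i j ->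
        {in 1%g :: F, forall g, normc (phi j g - 1) < d}.
      by exists i; apply: iP.
    elim: (1%g :: F) => [|g s [i iP]]; first by exists i0.
    have [j jP] := cvg g _ d0; have [k ik jk] := ledir i j.
    exists k => l kl h; rewrite inE => /predU1P[->|hs].
      by rewrite -norm_ltcE; apply: jP; apply: letr kl.
    by apply: iP hs; apply: letr kl.
  have [r r0 rE] := ge0_complexP (positive_definite_ge0 (pd i)).
  have dle : d <= 1 / 2 by rewrite ge_min lexx.
  have dle' : d <= e / 8 by rewrite ge_min lexx orbT.
  have h1 := iP 1%g (mem_head _ _).
  have r2 : 1 / 2 < r.
    move: h1; rewrite rE -[X in _ - X]/(1%:C%C) -rmorphB normc_real ltr_norml.
    by move=> /andP[h _]; lra.
  have rn0 : (r%:C%C : R[i]) != 0 by apply/eqP => -[] rr0; lra.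
  have rg0 : 0 < r by lra.
  have nV : normc (r%:C%C : R[i])^-1 = r^-1 by rewrite normcV normc_real gtr0_norm.
  exists (fun g => (r%:C%C)^-1 * phi i g); split.
  - apply/positive_definite_psd => n g; apply: psd_scale.
      by rewrite invr_ge0 -[0]/(0%:C%C) lecR.
    exact: (positive_definite_psd _).1.
  - move=> d' d'0; have := van i (d' / 2); rewrite divr_gt0 // => /(_ isT).
    apply: sub_finite_set => g /=; rewrite !norm_gecE normcM nV => h.
    have h3 : d' * r <= normc (phi i g) by rewrite mulrC -ler_pdivlMl.
    apply: le_trans h3; nra.
  - by rewrite rE mulVf.
  - move=> g gF; have h2 := iP g (@mem_behead _ (1%g :: F) _ gF).
    have -> : (r%:C%C)^-1 * phi i g - 1 =
        (r%:C%C)^-1 * ((phi i g - 1) - (phi i 1%g - 1)).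
      by rewrite rE; field.
    rewrite normcM nV mulrC ltr_pdivrMr //.
    apply: le_lt_trans (le_normcD _ _) _; rewrite normcN.
    nra.
move=> appr.
(* Conversely, the net is indexed by finite subsets together with tolerances 1 / (n + 1). *)
have /choice[phi phiP] : forall Fn : {fset G} * nat, exists phi : G -> R[i],
    [/\ positive_definite phi, vanishes_at_infinity phi, phi 1%g = 1 &
        {in Fn.1, forall g, normc (phi g - 1) < Fn.2.+1%:R^-1}].
  by move=> [F n]; apply: appr; rewrite invr_gt0.
exists ({fset G} * nat)%type,
  (fun F F' => (F.1 `<=` F'.1)%fset /\ (F.2 <= F'.2)%N), phi; split.
- split=> [|i|i j k [a b] [c d]|i j].
  + by constructor; exact: (fset0, 0%N).
  + by split.
  + by split; [apply: fsubset_trans c|apply: leq_trans d].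
  + exists (i.1 `|` j.1, maxn i.2 j.2)%fset; split=> /=;
    by rewrite ?fsubsetUl ?fsubsetUr ?leq_maxl ?leq_maxr.
- by move=> i; case: (phiP i).
- by move=> i; case: (phiP i).
- move=> g e e0.
  have [n nP] : exists n : nat, n.+1%:R^-1 < e.
    exists (Num.truncn e^-1); rewrite invf_plt ?posrE //.
    exact: truncnS_gt.
  exists ([fset g]%fset, n) => -[F m] /= [gF nm]; rewrite norm_ltcE.
  have [_ _ _ /(_ g) h] := phiP (F, m).
  apply: lt_trans nP; apply: lt_le_trans (h _) _ => /=.
    by move/fsubsetP: gF; apply; rewrite inE.
  by rewrite lef_pV2 ?posrE // ler_nat.
Qed.

End Approximation.

(** Positive definite functions pull back along f, and injectivity keeps preimages of finite sets
    finite. *)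
Lemma haagerup_inj (R : realType) (G H : groupType) (f : G -> H) :
  {morph f : x y / (x * y)%g} -> injective f -> haagerup R H -> haagerup R G.
Proof.
move=> fM fI /haagerupP hH; apply/haagerupP => F e e0.
have f1 : f 1%g = 1%g by apply: (@mulgI _ (f 1%g)); rewrite -fM !mulg1.
have fV x : f x^-1%g = (f x)^-1%g by apply: (@mulgI _ (f x)); rewrite -fM !mulgV.
have [phi [pd van phi1 phiF]] := hH (map f F) e e0.
exists (phi \o f); split.
- by move=> n g c; under eq_bigr => i _ do under eq_bigr =>
  j _ do rewrite /= fM fV; apply: pd.
- move=> d d0; apply: (@finite_preimage _ _ [set g | d%:C%C <= `|phi g|] f);
  last exact: van.
  by move=> x y _ _; apply: fI.
- by rewrite /= f1.
- by move=> g gF /=; apply: phiF; apply: map_f.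
Qed.

(** * Extension by the integers *)

Definition Zmul : Type := int.
HB.instance Definition _ := Choice.copy Zmul int.
HB.instance Definition _ := isGroup.Build Zmul
  (@addrA int) (@add0r int) (@addr0 int) (@addNr int) (@subrr int).

Lemma sd_mulE (N H : groupType) (f : group_action N H) (p q : sdprod_type f) :
  (p * q)%g = (p.1 * f p.2 q.1, p.2 * q.2)%g.
Proof. by []. Qed.

Lemma sd_invE (N H : groupType) (f : group_action N H) (p : sdprod_type f) :
  (p^-1)%g = (f p.2^-1 p.1^-1, p.2^-1)%g.
Proof. by []. Qed.

Lemma sd_divE (N H : groupType) (f : group_action N H) (p q : sdprod_type f) :
  (p^-1 * q)%g = (f p.2^-1 (p.1^-1 * q.1), p.2^-1 * q.2)%g.
Proof. by rewrite sd_mulE sd_invE /= act_morph. Qed.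

Section IntegerExtension.
Variables (R : realType) (G : groupType) (theta : group_aut G).

Definition aut_action : group_action G Zmul :=
  @GroupAction G Zmul (fun k => aut_pow theta k) (fun=> erefl)
    (fun g h n => aut_powD theta g h n) (fun k => aut_pow_morph theta k).

Definition Zext : groupType := sdprod_type aut_action.

(* Foelner averaging over the windows [0, N) of Z. *)
Definition in_window (N : nat) (z : int) : R[i] := (0 <= z < N%:Z)%R%:R.

(** The substitution k = t - s moves window sums with different shifts s to one common range [0, T),
    where they can be compared term by term. *)
Lemma window_shift (N T : nat) (s : int) (F : int -> R[i]) :
  0 <= s -> s + N%:Z <= T%:Z ->
  \sum_(k < N) F k%:Z = \sum_(t < T) in_window N (t%:Z - s) * F (t%:Z - s).
Proof.
case: s => // a _ aT; have [b ->] : exists b, T = (a + (N + b))%N.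
  by exists (T - (a + N))%N; lia.
rewrite big_split_ord /= [X in _ = X + _]big1 ?add0r; last first.
  move=> i _; rewrite /in_window; case: (boolP (_ && _)) => [/andP[h _]|_];
    last by rewrite mul0r.
  by have := ltn_ord i; lia.
rewrite big_split_ord /= [X in _ = _ + X]big1 ?addr0; last first.
  move=> i _; rewrite /in_window; case: (boolP (_ && _)) => [/andP[_ h]|_];
    last by rewrite mul0r.
  by exfalso; lia.
apply: eq_bigr => i _; have -> : (a + i)%N%:Z - a%:Z = i%:Z by lia.
by rewrite /in_window ltz_nat ltn_ord mul1r.
Qed.

(** For positive definite phi this is a matrix coefficient of the representation induced from G, at
    the normalized indicator of [0, N). *)
Definition Zavg (N : nat) (phi : G -> R[i]) (g : Zext) : R[i] :=
  (N%:R^-1)%:C%C *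
  \sum_(k < N) in_window N (k%:Z + g.2) * phi (aut_pow theta k g.1).

Lemma Zavg_pd N phi : positive_definite phi -> positive_definite (Zavg N phi).
Proof.
move=> /positive_definite_psd pd; apply/positive_definite_psd => n g.
apply: psd_scale; first by rewrite -[0]/(0%:C%C) lecR invr_ge0.
pose M : int := \sum_(i < n) `|(g i).2 : int|.
have gM i : `|(g i).2 : int| <= M.
  by rewrite /M (bigD1 i) //= lerDl sumr_ge0.
pose T := (N + `|M|%N + `|M|%N)%N.
(* With n_i the integer part of g i, put k = t - M + n_i. The two windows then form a rank-one
   kernel, and phi is evaluated at theta^(t - M) of x_i^-1 x_j; since M bounds all |n_i|, every
   relevant t lies in [0, T). *)
apply: (@psd_ext _ _ (fun i j => \sum_(t < T)
   ((in_window N (t%:Z - M + (g i).2))^* * in_window N (t%:Z - M + (g j).2)) *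
   phi ((aut_pow theta (t%:Z - M) (g i).1)^-1 * aut_pow theta (t%:Z - M) (g
     j).1)%g)).
  move=> i j; rewrite [in RHS]sd_divE /=.
  have gi := gM i; have M0 : 0 <= M by apply: le_trans gi.
  rewrite (@window_shift N T (M - (g i).2) (fun k =>
    in_window N (k + ((g i).2^-1 * (g j).2)%g) *
      phi (aut_pow theta k (aut_pow theta (g i).2^-1%g ((g i).1^-1 * (g
        j).1)%g)))); last 2 first.
  - by move: gi; rewrite ler_norml => /andP[_]; rewrite subr_ge0.
  - rewrite /T !PoszD gez0_abs //; move: gi; rewrite ler_norml => /andP[h _].
    by move: h; set u : int := (g i).2; lia.
  apply: eq_bigr => t _; rewrite -mulrA; congr (_ * (in_window N _ * phi _)).
  - by rewrite conjC_nat /in_window; congr (_%:R); rewrite opprB addrA addrAC.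
  - rewrite -[((g i).2^-1 * (g j).2)%g]/(- ((g i).2 : int) + ((g j).2 : int)).
    by set u : int := (g i).2; set v : int := (g j).2; lia.
  - rewrite -aut_powD -[(g i).2^-1%g]/(- ((g i).2 : int)).
    have -> : t%:Z - (M - (g i).2) + - ((g i).2 : int) = t%:Z - M.
      by set u : int := (g i).2; lia.
    rewrite aut_pow_morph; congr (_ * _)%g.
    by apply: (@mulgI _ (aut_pow theta (t%:Z - M) (g i).1));
      rewrite -aut_pow_morph !mulgV aut_pow1.
apply: psd_sum => t; apply: psd_mul; last exact: pd.
exact: (psd_rank1 (fun i => in_window N (t%:Z - M + (g i).2))).
Qed.

Lemma aut_powV k x : aut_pow theta (- k) (aut_pow theta k x) = x.
Proof. by rewrite -aut_powD addNr. Qed.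

Lemma normc_sum (I : Type) (s : seq I) (F : I -> R[i]) :
  normc (\sum_(i <- s) F i) <= \sum_(i <- s) normc (F i).
Proof.
elim: s => [|i s IH]; first by rewrite !big_nil normc0.
by rewrite !big_cons (le_trans (le_normcD _ _)) // lerD2l.
Qed.

Lemma normc_window N z : normc (in_window N z) = (0 <= z < N%:Z)%R%:R.
Proof. by rewrite /in_window; case: (_ && _); rewrite ?normc1 ?normc0. Qed.

(** A value of modulus at least e at (x, n) requires some k with k and l = k + n in the window and
    |phi(theta^k x)| >= e. Then (x, n) is determined by k, l and an element of a finite set. *)
Lemma Zavg_van N phi : (0 < N)%N ->
  vanishes_at_infinity phi -> vanishes_at_infinity (Zavg N phi).
Proof.
move=> N0 van e e0; have fin := van e e0.
pose S := [set g | e%:C%C <= `|phi g|].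
apply: (@sub_finite_set _ _ ((fun t : G * ('I_N * 'I_N) =>
   (aut_pow theta (- t.2.1%:Z) t.1, t.2.2%:Z - t.2.1%:Z) : Zext) @` (S `*`
     setT))); last first.
  by apply: finite_image; apply: finite_setX => //; exact: finite_finset.
move=> [x n]; rewrite /= norm_gecE /Zavg /= => h.
have [k /andP[kn /negP kP]] : exists k : 'I_N,
    (0 <= k%:Z + (n : int) < N%:Z)%R && ~~ (normc (phi (aut_pow theta k x)) < e).
  apply/existsP; apply: contraT; rewrite negb_exists => /forallP hk.
  have Np : 0 < N%:R :> R by rewrite ltr0n.
  have : normc (\sum_(k < N) in_window N (k%:Z + (n : int)) * phi (aut_pow theta
    k x)) < N%:R * e.
    apply: le_lt_trans (normc_sum _ _) _.
    have -> : N%:R * e = \sum_(k < N) e by rewrite sumr_const card_ord mulr_natl.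
    apply: ltr_sum => [|k _]; first by apply/hasP; exists (Ordinal N0) => //;
      rewrite mem_index_enum.
    rewrite normcM normc_window; move: (hk k); case: (boolP (0 <= _ < _)%R) =>
      _ /=; last by rewrite mul0r.
    by rewrite negbK mul1r.
  move: h; rewrite normcM normc_real ger0_norm ?invr_ge0 // -ler_pdivrMl
    ?invr_gt0 // invrK.
  by move=> h1 h2; have := lt_le_trans h2 h1; rewrite ltxx.
move/negP: kP; rewrite -leNgt -norm_gecE => kP.
have [l lE] : exists l : 'I_N, l%:Z = k%:Z + (n : int).
  case: (k%:Z + (n : int)) kn => // m mN; exists (Ordinal (mN : (m < N)%N)) => //.
exists (aut_pow theta k x, (k, l)) => /=; first by split.
by rewrite aut_powV lE; congr (_, _); rewrite addrC addKr.
Qed.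

Lemma sum_lt_ord (N m : nat) : (\sum_(k < N) (k < m) <= m)%N.
Proof.
suff -> : (\sum_(k < N) (k < m) = minn N m)%N by rewrite geq_minr.
elim: N => [|N IH]; first by rewrite big_ord0 min0n.
by rewrite big_ord_recr /= IH; case: ltnP; lia.
Qed.

(** For n >= 0 the indices lost are the last ones, for n < 0 the first ones; reversing the order
    reduces both cases to [sum_lt_ord]. *)
Lemma window_complement (N : nat) (n : int) :
  (\sum_(k < N) ~~ (0 <= k%:Z + n < N%:Z)%R <= `|n|)%N.
Proof.
case: n => m.
  rewrite (reindex_inj rev_ord_inj) /=; apply: leq_trans (sum_lt_ord N m).
  by apply: leq_sum => i _; have := ltn_ord i; lia.
apply: leq_trans (sum_lt_ord N m.+1).
by apply: leq_sum => i _; have := ltn_ord i; lia.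
Qed.

Lemma haagerup_Zext : haagerup R G -> haagerup R Zext.
Proof.
move=> /haagerupP hG; apply/haagerupP => F e e0.
pose B := (\sum_(g <- F) `|(g.2 : int)|)%N.
(* At most B indices leave the window under a shift coming from F, and N > 2B / e makes their share
   less than e / 2. The other e / 2 is the error of phi on the theta^k-images of F. *)
pose N := (Num.truncn (2 * B%:R / e)).+1.
have N0 : 0 < N%:R :> R by rewrite ltr0n.
have BN : B%:R / N%:R < e / 2.
  have : 2 * B%:R / e < N%:R by exact: truncnS_gt.
  by rewrite !ltr_pdivrMr // => h; lra.
have [phi [pd van phi1 phiF]] :=
  hG [seq aut_pow theta k%:Z g.1 | k <- iota 0 N, g <- F] (e / 2) ltac:(by lra).
exists (Zavg N phi); split.
- exact: Zavg_pd.
- exact: Zavg_van.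
- rewrite /Zavg /=; have -> : \sum_(k < N) in_window N (k%:Z + (0 : int)) * phi
  (aut_pow theta k 1%g) = N%:R.
    under eq_bigr => k _.
      rewrite aut_pow1 phi1 mulr1 addr0 /in_window ltz_nat ltn_ord.
      over.
    by rewrite sumr_const card_ord.
  by rewrite fmorphV rmorph_nat mulVf // pnatr_eq0.
- move=> g gF; have gB : (`|(g.2 : int)| <= B)%N.
    by rewrite /B (big_rem g) //= leq_addr.
  have NC : N%:R != 0 :> R[i] by rewrite pnatr_eq0.
  have -> : Zavg N phi g - 1 = (N%:R^-1)%:C%C *
      \sum_(k < N) (in_window N (k%:Z + g.2) * phi (aut_pow theta k g.1) - 1).
    rewrite sumrB sumr_const card_ord mulrBr; congr (_ - _).
    by rewrite fmorphV rmorph_nat mulVf.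
  rewrite normcM normc_real ger0_norm ?invr_ge0 ?ltW // ltr_pdivrMl //.
  apply: le_lt_trans (normc_sum _ _) _.
  apply: (@le_lt_trans _ _ (\sum_(k < N) (e / 2 + (~~ (0 <= k%:Z + (g.2 : int) <
    N%:Z)%R)%:R))).
    apply: ler_sum => k _; rewrite /in_window; case: (_ && _) => /=.
      rewrite mul1r addr0 ltW //; apply: phiF; apply: allpairs_f => //.
      by rewrite mem_iota ltn_ord.
    by rewrite mul0r add0r normcN normc1 lerDr; lra.
  rewrite big_split /= sumr_const card_ord -natr_sum -[e / 2 *+ N]mulr_natl.
  apply: (@le_lt_trans _ _ (N%:R * (e / 2) + B%:R)).
    by rewrite lerD2l ler_nat (leq_trans (window_complement _ _)).
  move: BN; rewrite ltr_pdivrMr // => h; lra.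
Qed.

End IntegerExtension.

(** * Dyadic affine maps *)

Section DyadicMaps.
Variable R : realType.
Implicit Types (x y : I01 R) (p q k : nat * nat) (v : I01 R -> I01 R).

Let pow2n0 n : 2 ^+ n != 0 :> R := pow2_neq0 R n.
Let pow2g0 n : 0 < 2 ^+ n :> R := pow2_gt0 R n.

Definition I01_0 : I01 R := exist _ 0 (I01_zero_subproof R).

Fact I01_half_subproof : 0 <= (1 / 2 : R) < 1.
Proof. by apply/andP; split; lra. Qed.

Definition I01_half : I01 R := exist _ (1 / 2) I01_half_subproof.

(** The increasing affine bijection from [0, 1) onto [ditv p]; the default value is never reached
    when [dok p] holds. *)
Definition dmap p x : I01 R := insubd I01_0 ((p.2%:R + \val x) / 2 ^+ p.1).

Lemma dmapE p x : dok p -> \val (dmap p x) = (p.2%:R + \val x) / 2 ^+ p.1.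
Proof.
move=> ok; have /andP[x0 x1] := valP x.
have [|y yE _] := @ditv_mk R p ((p.2%:R + \val x) / 2 ^+ p.1) ok.
  by rewrite mulfVK // lerDl x0 ltrD2l.
by rewrite /dmap -yE valKd.
Qed.

Lemma ditv_dmap p x : dok p -> ditv p (dmap p x).
Proof.
move=> ok; apply/ditvE; have /andP[x0 x1] := valP x.
by rewrite dmapE // mulfVK // lerDl x0 ltrD2l.
Qed.

Lemma ditv_dmapP p y : dok p -> ditv p y -> exists x, y = dmap p x.
Proof.
move=> ok /ditvE/andP[h1 h2].
have x01 : 0 <= \val y * 2 ^+ p.1 - p.2%:R < 1 by apply/andP; split; lra.
exists (exist (fun u => is_true (0 <= u < 1)) _ x01); apply: val_inj;
  rewrite dmapE //=.
by rewrite addrCA subrr addr0 mulfK.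
Qed.

(** The values at 0 and 1/2 determine the left endpoint and the length of the interval. *)
Lemma dmap_index_inj p q : dok p -> dok q ->
  dmap p I01_0 = dmap q I01_0 -> dmap p I01_half = dmap q I01_half -> p = q.
Proof.
move=> okp okq /(congr1 \val) + /(congr1 \val); rewrite !dmapE //= !addr0 => h0 h1.
have e : (2 ^+ p.1 : R)^-1 = (2 ^+ q.1)^-1.
  move: h1; rewrite !mulrDl h0 => /addrI; rewrite !mul1r.
  by move=> /(mulfI (_ : 2^-1 != 0)); apply; rewrite invr_neq0 // pnatr_eq0.
have e1 : p.1 = q.1.
  move/invr_inj: e; rewrite -!natrX => /eqP; rewrite eqr_nat => /eqP h.
  by apply/eqP; rewrite -(@eqn_exp2l 2) // h.
move: h0; rewrite e1 => /(mulIf (invr_neq0 (pow2n0 _))) /eqP; rewrite eqr_nat =>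
  /eqP e2.
by rewrite [p]surjective_pairing [q]surjective_pairing e1 e2.
Qed.

Lemma dmap_child p k x : dok p -> dok k -> dmap (dchild p k) x = dmap p (dmap k x).
Proof.
move=> okp okk; have okpk := dchild_ok okp okk; apply: val_inj; rewrite !dmapE //.
by rewrite /dchild /= natrD natrM pow2_nat exprD; field; rewrite !pow2n0.
Qed.

Lemma dmap_eq0 p x : dok p -> \val (dmap p x) = 0 -> \val x = 0.
Proof.
move=> ok; rewrite dmapE // => /eqP; rewrite mulf_eq0 invr_eq0 (negbTE (pow2n0
  _)) orbF.
by rewrite paddr_eq0 ?ler0n //; [case/andP=> _ /eqP|case/andP: (valP x)].
Qed.

Lemma daff_dmap p q v x : dok p -> dok q -> daff p q v -> v (dmap p x) = dmap q x.
Proof.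
move=> okp okq h; apply: val_inj; rewrite (h _ (ditv_dmap x okp)) !dmapE //.
by rewrite mulfVK // [p.2%:R + _]addrC addrK.
Qed.

Lemma dmap_cover n y : exists2 a, dok (n, a) & exists x, y = dmap (n, a) x.
Proof.
have /andP[y0 y1] := valP y.
have h0 : 0 <= \val y * 2 ^+ n by rewrite mulr_ge0 // ltW.
pose a := Num.truncn (\val y * 2 ^+ n); have /andP[a1 a2] := truncn_itv h0.
have ok : dok (n, a).
  rewrite /dok /= -(ltr_nat R) natrX (le_lt_trans a1) // -[X in _ < X]mul1r.
  by rewrite ltr_pM2r.
by exists a => //; apply: ditv_dmapP => //; apply/ditvE; rewrite /= a1 natr1.
Qed.

(** For n <= [p.1], the standard dyadic interval of length 2^-n that contains [ditv p]. *)
Definition ancestor n p : nat * nat := (n, (p.2 %/ 2 ^ (p.1 - n))%N).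

Lemma ancestorP n p : dok p -> (n <= p.1)%N ->
  [/\ dok (ancestor n p) &
      exists2 k, dok k & p = dchild (ancestor n p) k /\ p.1 = (n + k.1)%N].
Proof.
case: p => m a; rewrite /dok /= => ok nm; split.
  by rewrite ltn_divLR ?expn_gt0 // -expnD subnKC.
exists (m - n, a %% 2 ^ (m - n))%N; first by rewrite /dok /= ltn_mod expn_gt0.
by rewrite /dchild /= subnKC // -divn_eq.
Qed.

Definition dyadic_level n : set (I01 R) :=
  [set y | exists2 a, dok (n, a) & y = dmap (n, a) I01_0].

Lemma dyadic_level_finite n : finite_set (dyadic_level n).
Proof.
apply: (@sub_finite_set _ _ ((fun a => dmap (n, a) I01_0) @` `I_(2 ^ n))).
  by move=> y [a ok ->]; exists a.
by apply: finite_image; apply: finite_II.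
Qed.

Lemma dyadic_levelE n y : dyadic_level n y <-> \val y * 2 ^+ n \is a Num.nat.
Proof.
split=> [[a ok ->]|]; first by rewrite dmapE //= addr0 mulfVK // natr_nat.
move=> /natrP[a aE].
have ok : dok (n, a).
  rewrite /dok /= -(ltr_nat R) -aE natrX -[X in _ < X]mul1r ltr_pM2r //.
  by case/andP: (valP y).
exists a => //; apply: val_inj; rewrite dmapE //= addr0.
by apply: (mulIf (pow2n0 n)); rewrite mulfVK.
Qed.

Lemma dyadic_level_le n m y : (n <= m)%N -> dyadic_level n y -> dyadic_level m y.
Proof.
move=> nm /dyadic_levelE h; apply/dyadic_levelE.
by rewrite -(subnKC nm) exprD mulrA rpredM // rpredX // natr_nat.
Qed.

Lemma dyadic_level_half p : dok p -> dyadic_level p.1.+1 (dmap p I01_half).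
Proof.
move=> ok; apply/dyadic_levelE; rewrite dmapE //= exprS.
have -> : (p.2%:R + 1 / 2) / 2 ^+ p.1 * (2 * 2 ^+ p.1) = (p.2 * 2 + 1)%:R :> R.
  by rewrite natrD natrM; field.
exact: natr_nat.
Qed.

Lemma dyadic_level_dmap0 p : dok p -> dyadic_level p.1 (dmap p I01_0).
Proof. by move=> ok; exists p.2; rewrite -?surjective_pairing. Qed.

(** The endpoints of [ditv p] are consecutive multiples of 2^-p.1, and only the left one belongs to
    it. *)
Lemma dyadic_level_dmap p x : dok p -> dyadic_level p.1 (dmap p x) -> \val x = 0.
Proof.
move=> ok /dyadic_levelE; rewrite dmapE // mulfVK // => /natrP[a aE].
have /andP[x0 x1] := valP x.
have xE : \val x = a%:R - p.2%:R by rewrite -aE addrC addKr.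
have le : (p.2 <= a)%N by rewrite -(ler_nat R) -subr_ge0 -xE.
have lt : (a < p.2.+1)%N by rewrite -(ltr_nat R) -natr1; lra.
by have -> : \val x = 0 by rewrite xE (_ : a = p.2) ?subrr //; lia.
Qed.

Lemma is_dyadicP y : is_dyadic (\val y) <-> exists n, dyadic_level n y.
Proof.
split=> [[a [n e]]|[n [a ok ->]]]; last first.
  by exists a%:Z, n; rewrite dmapE //= addr0.
exists n; apply/dyadic_levelE; rewrite e mulfVK //.
have : 0 <= (a%:~R : R).
  rewrite -[a%:~R](mulfVK (pow2n0 n)) -e mulr_ge0 //.
  by case/andP: (valP y).
by rewrite ler0z; case: a {e} => // a _; rewrite -pmulrn natr_nat.
Qed.

End DyadicMaps.

(** * The untwisted wreath product *)

Definition symdiff (T : Type) (A B : set T) : set T := (A `\` B) `|` (B `\` A).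

Lemma symdiffC (T : Type) (A B : set T) : symdiff A B = symdiff B A.
Proof. exact: setUC. Qed.

Lemma image_setD_inj (T U : Type) (f : T -> U) (A B : set T) : injective f ->
  f @` (A `\` B) = (f @` A) `\` (f @` B).
Proof.
move=> fI; apply/seteqP; split=> [_ [x [Ax nB] <-]|_ [[x Ax <-] nB]].
  by split; [exists x|move=> [z Bz /fI zx]; apply: nB; rewrite -zx].
by exists x => //; split=> // Bx; apply: nB; exists x.
Qed.

Lemma image_symdiff (T U : Type) (f : T -> U) (A B : set T) : injective f ->
  symdiff (f @` A) (f @` B) = f @` symdiff A B.
Proof. by move=> fI; rewrite image_setU !image_setD_inj. Qed.

(** * Positive definiteness of lam to the size of a symmetric difference *)

Section SymdiffKernel.
Variables (R : realType) (E : choiceType) (lam : R).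
Hypothesis lam01 : 0 <= lam <= 1.

(** The kernel is lam times the constant kernel plus 1 - lam times the equality kernel, and the
    latter is a sum of two rank-one kernels. *)
Lemma psd_separation n (b : 'I_n -> bool) :
  psd (fun i j => if b i == b j then 1 else lam%:C%C : R[i]).
Proof.
have /andP[l0 l1] := lam01.
apply: (@psd_ext _ _ (fun i j => lam%:C%C * 1 + (1 - lam%:C%C) *
   (((b i)%:R)^* * (b j)%:R + ((~~ b i)%:R)^* * (~~ b j)%:R))).
  move=> i j; rewrite !conjC_nat mulr1.
  by case: (b i); case: (b j) => /=; rewrite ?mul0r ?mulr0 ?mul1r ?addr0 ?add0r
    ?mulr0 ?addr0 ?mulr1 ?subrKC.
apply: psd_add; first by apply: psd_scale; [rewrite -[0]/(0%:C%C) lecR|apply: psd1].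
apply: psd_scale; first by rewrite subr_ge0 -[1]/(1%:C%C) lecR.
by apply: psd_add; [apply: (psd_rank1 (fun i =>
  (b i)%:R))|apply: (psd_rank1 (fun i => (~~ b i)%:R))].
Qed.

Lemma prod_fset_const (A D : {fset E}) (a : R[i]) : (A `<=` D)%fset ->
  a ^+ #|` A| = \prod_(e <- D) (if e \in A then a else 1).
Proof.
move=> AD; rewrite -(big_fset_incl _ AD) => [|e _ /negbTE -> //].
rewrite big_seq (eq_bigr (fun=> a)) => [|e ->//]; rewrite -big_seq.
by rewrite big_const_seq count_predT iter_mulr mulr1.
Qed.

(** Each e contributes a factor lam when it separates S i from S j and 1 otherwise. Only the
    finitely many elements of D separate any pair, so one finite Schur product covers all i and
    j. *)
Lemma psd_symdiff n (S : 'I_n -> set E) :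
  (forall i j, finite_set (symdiff (S i) (S j))) ->
  psd (fun i j => (lam%:C%C : R[i]) ^+ #|` fset_set (symdiff (S i) (S j))|).
Proof.
move=> fin.
pose D := fset_set (\bigcup_(ij : 'I_n * 'I_n) symdiff (S ij.1) (S ij.2)).
have finU : finite_set (\bigcup_(ij : 'I_n * 'I_n) symdiff (S ij.1) (S ij.2)).
  by apply: bigcup_finite; [exact: finite_finset|move=> ij _; apply: fin].
apply: (@psd_ext _ _ (fun i j => \prod_(e <- D)
   (if `[< S i e >] == `[< S j e >] then 1 else lam%:C%C))); last first.
  by apply: psd_prod => e; apply: psd_separation.
move=> i j; rewrite (@prod_fset_const _ D); last first.
  by rewrite -fset_set_sub // => e he; exists (i, j).
apply: eq_bigr => e _; rewrite in_fset_set //.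
case: (boolP (e \in symdiff _ _)); rewrite ?inE /symdiff /=.
  by move=> -[] [/asboolT -> /asboolF ->].
rewrite notin_setE => h; case: (pselect (S i e)) => [Si|Si];
  case: (pselect (S j e)) => [Sj|Sj].
- by rewrite !asboolT.
- by exfalso; apply: h; left.
- by exfalso; apply: h; right.
- by rewrite !asboolF.
Qed.

End SymdiffKernel.

(** Finitely many evaluations, each with finitely many values, that jointly separate the points of
    A: split A into the fibres of one evaluation and recurse. *)
Lemma finite_set_evals (T I U : Type) (f : I -> T -> U) (s : seq I) (A : set T) :
  (forall i, List.In i s -> finite_set (f i @` A)) ->
  (forall x y, A x -> A y -> (forall i, List.In i s -> f i x = f i y) -> x = y) ->
  finite_set A.
Proof.
elim: s A => [|i s IH] A fin inj.
  have [->|/set0P[x Ax]] := eqVneq A set0; first exact: finite_set0.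
  apply: (@sub_finite_set _ _ [set x]); last exact: finite_set1.
  by move=> y Ay; apply: inj.
have -> : A = \bigcup_(u in f i @` A) (A `&` [set x | f i x = u]).
  apply/seteqP; split=> [x Ax|x [u _ []] //].
  by exists (f i x); [exists x|split].
apply: bigcup_finite => [|u _]; first by apply: fin; left.
apply: IH => [j js|x y [Ax fx] [Ay fy] h].
  apply: (@sub_finite_set _ _ (f j @` A)); last by apply: fin; right.
  by move=> _ [x [Ax _] <-]; exists x.
by apply: inj => // j [<-|]; [rewrite fx fy|apply: h].
Qed.

(** * The action on placed intervals and the length it defines *)

Section UntwistedWreath.
Variables (R : realType) (L : groupType).

Definition id_aut : group_aut L :=
  @GroupAut L id id (fun _ _ => erefl) (fun=> erefl) (fun=> erefl).

Lemma id_aut_pow k x : aut_pow id_aut k x = x.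
Proof. by case: k => n; rewrite /aut_pow; [elim: n|elim: n.+1]. Qed.

Notation W := (twisted_wreath R id_aut).
Notation B := (dsum (Q2 R) L).
Implicit Types (g h : W) (x y : I01 R) (p q : nat * nat) (b : B).

Definition label b x : L := oapp b 1%g (insub x : option (Q2 R)).

Lemma label_val b (x : Q2 R) : label b (\val x) = b x.
Proof. by rewrite /label valK. Qed.

Lemma label_1 x : label 1%g x = 1%g.
Proof. by rewrite /label; case: insub => //= y; exact: ds_oneE. Qed.

Lemma label_M b c x : label (b * c)%g x = (label b x * label c x)%g.
Proof.
by rewrite /label; case: insub => [y|] /=; [exact: ds_mulE|rewrite mulg1].
Qed.

Lemma label_twist v b x : label (twist id_aut v b) (v x) = label b x.
Proof.
rewrite /label; case: insubP => [y _ yE|nd] /=.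
  have xE : x = \val (V_Q2 v^-1%g y) by rewrite V_Q2_val yE; exact/esym/V_invK.
  by rewrite xE valK /= twistE id_aut_pow.
case: insubP => [y _ yE|//] /=; exfalso; move/negP: nd; apply.
rewrite -yE; apply: asboolT; apply: thompson_dyadic; exact: asboolW (valP y).
Qed.

(* The value at 0 ignores the label of the left endpoint: otherwise a single  *)
(* label would disturb the infinitely many intervals starting at its point.   *)
Definition placement g p : (I01 R -> I01 R) * (I01 R -> L) :=
  ((g.2 : thompsonV R) \o dmap p,
   fun x => if \val x == 0 then 1%g
            else label g.1 ((g.2 : thompsonV R) (dmap p x))).

(** The action that sends [placement 1 p] to [placement g p]; it leaves the value at 0 alone, in
    accordance with [placement]. *)
Definition move_placement g (e : (I01 R -> I01 R) * (I01 R -> L)) :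
    (I01 R -> I01 R) * (I01 R -> L) :=
  ((g.2 : thompsonV R) \o e.1,
   fun x => if \val x == 0 then e.2 x
            else (label g.1 ((g.2 : thompsonV R) (e.1 x)) * e.2 x)%g).

Lemma V_inj (v : thompsonV R) : injective v.
Proof. exact: can_inj (V_invK v). Qed.

Lemma move_placement_inj g : injective (move_placement g).
Proof.
move=> [f b] [f' b'] [/= ff bb].
have e : f = f' by apply/funext => x; apply: (@V_inj g.2);
  apply: (congr1 (@^~ x) ff).
subst f'; congr pair; apply/funext => x; move/(congr1 (@^~ x)): bb => /=.
by case: ifP => // _ /mulgI.
Qed.

Lemma move_placementE h g p :
  placement (h * g)%g p = move_placement h (placement g p).
Proof.
congr pair; apply/funext => x /=; case: ifP => // _.
rewrite label_M; congr (_ * _)%g.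
exact: label_twist.
Qed.

Definition placements g : set ((I01 R -> I01 R) * (I01 R -> L)) :=
  placement g @` @dok.

Lemma placements_M h g : placements (h * g)%g = move_placement h @` placements g.
Proof.
rewrite /placements image_comp; apply: eq_imagel => p _.
exact: move_placementE.
Qed.

Lemma placement1 p : placement 1%g p = (dmap p, fun=> 1%g).
Proof.
by congr pair; apply/funext => x //=; case: ifP => // _; rewrite label_1.
Qed.

Lemma placement_goodP g p q : placement g p = placement 1%g q <->
  (forall x, (g.2 : thompsonV R) (dmap p x) = dmap q x) /\
  (forall x, \val x != 0 -> label g.1 (dmap q x) = 1%g).
Proof.
rewrite placement1; split=> [[e1 e2]|[e1 e2]].
  have e x : (g.2 : thompsonV R) (dmap p x) = dmap q x := congr1 (@^~ x) e1.
  split=> // x /negbTE x0; have := congr1 (@^~ x) e2.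
  by rewrite /= x0 e.
congr pair; apply/funext => x //=; case: ifP => // /negbT.
by rewrite e1; apply: e2.
Qed.

(** A nonzero x has nonzero image under [dmap k], so the ignored left endpoint of p is never an
    inner point of the child. By contraposition, the ancestors of a misplaced interval are
    misplaced. *)
Lemma placement_child g p q k : dok p -> dok q -> dok k ->
  placement g p = placement 1%g q ->
  placement g (dchild p k) = placement 1%g (dchild q k).
Proof.
move=> okp okq okk /placement_goodP[e1 e2]; apply/placement_goodP; split=> x.
  by rewrite !dmap_child.
move=> x0; rewrite dmap_child //; apply: e2.
by apply: contra x0 => /eqP/(dmap_eq0 okk) ->.
Qed.

Lemma placement_inj g p q : dok p -> dok q ->
  placement g p = placement g q -> p = q.
Proof.
move=> okp okq [e _]; apply: (dmap_index_inj okp okq);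
by apply: (@V_inj g.2); apply: (congr1 (@^~ _) e).
Qed.

Lemma large_level_good g : exists n, forall p, dok p -> (n <= p.1)%N ->
  placements 1%g (placement g p).
Proof.
have /is_thompsonP[_ [T [I [J [[Io Ix Ii] [Jo _ _] vIJ]]]]] :=
  thompsonVP (g.2 : thompsonV R).
have /choice[m mP] : forall y : Q2 R, exists n, dyadic_level n (\val y).
  by move=> y; apply/is_dyadicP; apply: asboolW (valP y).
pose b : B := g.1; pose v : thompsonV R := g.2.
(* The first bound puts p inside a piece on which v is affine. The second makes each preimage
   v^-1(y) of a support point a multiple of 2^-p.1, so it can meet p only at the ignored left
   endpoint. *)
exists (maxn (\max_i (I i).1) (\max_(y <- finsupp b) m (V_Q2 v^-1%g y)))%N => p okp.
rewrite geq_max => /andP[h1 h2].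
have [i xi] := Ix (dmap p (I01_0 R)).
have [|k okk pE] := ditv_nested _ xi (ditv_dmap (I01_0 R) okp).
  by apply: leq_trans h1; exact: (leq_bigmax i).
have okq : dok (dchild (J i) k) by apply: dchild_ok (Jo i) okk.
exists (dchild (J i) k) => //; apply/esym/placement_goodP.
have vE x : v (dmap p x) = dmap (dchild (J i) k) x.
  rewrite pE !dmap_child //; exact: daff_dmap.
split=> // x x0; rewrite -vE /label; case: insubP => //= y _ yE.
apply: dsum_out; apply: contra x0 => yS; apply/eqP.
apply: (dyadic_level_dmap okp).
have -> : dmap p x = \val (V_Q2 v^-1%g y).
  by rewrite V_Q2_val (_ : \val y = v (dmap p x)) //; exact/esym/V_invK.
apply: dyadic_level_le (mP _); apply: leq_trans h2.
exact: (@leq_bigmax_seq _ (enum_fset (finsupp b)) xpredT (fun z =>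
  m (V_Q2 v^-1%g z)) y yS).
Qed.

Lemma placements_diff_finite g : finite_set (placements g `\` placements 1%g).
Proof.
have [n nP] := large_level_good g.
apply: (@sub_finite_set _ _ (placement g @` (\bigcup_(m in `I_n) ((fun a =>
  (m, a)) @` `I_(2 ^ m))))).
  move=> _ [[p okp <-] bad]; exists p => //; exists p.1; last first.
    by exists p.2 => //; rewrite -surjective_pairing.
  by rewrite /= ltnNge; apply/negP => /(nP _ okp).
apply: finite_image; apply: bigcup_finite => [|m _]; first exact: finite_II.
by apply: finite_image; exact: finite_II.
Qed.

Lemma placements_symdiff_finite g h :
  finite_set (symdiff (placements g) (placements h)).
Proof.
have e : placements h = move_placement g @` placements (g^-1 * h)%g.
  by rewrite -placements_M mulVKg.
have e' : placements g = move_placement g @` placements 1%g.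
  by rewrite -placements_M mulg1.
rewrite e {1}e' image_symdiff; last exact: move_placement_inj.
apply: finite_image; set k := (g^-1 * h)%g.
rewrite /symdiff finite_setU; split; last exact: placements_diff_finite.
(* What k loses is, moved by k, what the inverse of k gains. *)
have -> : placements 1%g `\` placements k = move_placement k @` (placements
  k^-1%g `\` placements 1%g).
  rewrite image_setD_inj; last exact: move_placement_inj.
  by rewrite -!placements_M mulgV mulg1.
by apply: finite_image; apply: placements_diff_finite.
Qed.

Definition place_dist g h : nat :=
  #|` fset_set (symdiff (placements g) (placements h))|.

Lemma place_distC g h : place_dist g h = place_dist h g.
Proof. by rewrite /place_dist symdiffC. Qed.

Lemma place_dist_M k g h : place_dist (k * g)%g (k * h)%g = place_dist g h.
Proof.
rewrite /place_dist !placements_M image_symdiff; last exact: move_placement_inj.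
rewrite fset_set_image; last exact: placements_symdiff_finite.
by rewrite card_imfset //; apply: move_placement_inj.
Qed.

(* If p were misplaced, so would be its p.1 + 1 ancestors (p included). *)
Lemma place_dist_level g p : dok p -> (place_dist g 1%g <= p.1)%N ->
  exists2 q, dok q & placement g p = placement 1%g q.
Proof.
move=> okp le; suff [q okq e] : placements 1%g (placement g p) by exists q.
apply: contrapT => bad; move: le; apply/negP; rewrite -ltnNge.
pose E (j : 'I_p.1.+1) := placement g (ancestor j p).
have lej (j : 'I_p.1.+1) : (j <= p.1)%N by rewrite -ltnS.
have EI : injective E.
  move=> i j h; apply: val_inj; have [oki _] := ancestorP okp (lej i).
  have [okj _] := ancestorP okp (lej j).
  by case: (placement_inj oki okj h).
rewrite /place_dist.
have <- : #|` [fset E j | j in 'I_p.1.+1]%fset| = p.1.+1.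
  by rewrite card_imfset //= -cardE card_ord.
apply: fsubset_leq_card; apply/fsubsetP => _ /imfsetP[j _ ->].
rewrite in_fset_set; last exact: placements_symdiff_finite.
rewrite inE; left; have [okj [k okk [pE _]]] := ancestorP okp (lej j); split.
  by exists (ancestor j p).
move=> [q okq qE]; apply: bad; exists (dchild q k); first exact: dchild_ok.
by rewrite [in RHS]pE; apply/esym/placement_child.
Qed.

End UntwistedWreath.

(** * Finiteness of balls, and the Haagerup property of the untwisted wreath product *)

Section UntwistedWreathHaagerup.
Variables (R : realType) (L : groupType).
Notation W := (twisted_wreath R (id_aut L)).
Notation B := (dsum (Q2 R) L).
Implicit Types (g h : W) (b : B) (phi : L -> R[i]).

Lemma dsum_divE b c x : ((b^-1 * c)%g : B) x = ((b x)^-1 * c x)%g.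
Proof. by rewrite -[LHS]/(ds_mul (ds_inv b) c x) ds_mulE ds_invE. Qed.

Section LevelBound.
Variables (g : W) (r : nat).
Hypothesis gr : (place_dist g 1%g <= r)%N.

Let v : thompsonV R := g.2.

Lemma place_dist_inv : place_dist g^-1%g 1%g = place_dist g 1%g.
Proof. by rewrite -(place_dist_M g) mulgV mulg1 place_distC. Qed.

(** If q is finer than level r, let q' be its ancestor of level r. The inverse of g has the same
    length and hence places q' on some p', so p sits in p' as q sits in q'. Thus q is at most [p.1]
    = r levels below q'. *)
Lemma place_dist_image p : dok p -> p.1 = r ->
  exists q, [/\ dok q, (q.1 <= r + r)%N & placement g p = placement 1%g q].
Proof.
move=> okp pr; have [|q okq e] := place_dist_level (g := g) okp;
  first by rewrite pr.
exists q; split=> //; have [rq|/ltnW] := leqP r q.1; last first.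
  by move/leq_trans; apply; rewrite leq_addr.
have [okq' [k okk [qE q1]]] := ancestorP okq rq.
have [|p' okp' e'] := place_dist_level (g := g^-1%g) okq'.
  by rewrite place_dist_inv.
have [/= vE _] := (placement_goodP _ _ _).1 e.
have [/= vE' _] := (placement_goodP _ _ _).1 e'.
have pE : p = dchild p' k.
  have okp'k := dchild_ok okp' okk.
  have h (x : I01 R) : dmap p x = dmap (dchild p' k) x.
    rewrite dmap_child // -vE' -dmap_child // -qE -vE.
    exact/esym/V_invK.
  exact: dmap_index_inj.
by rewrite q1 leq_add2l -pr pE /= leq_addl.
Qed.

(** A point of level r + 1 is an endpoint or midpoint in an interval of level r, whose image has
    level at most 2r; halving costs one more level. *)
Lemma place_dist_value (x : I01 R) :
  dyadic_level r.+1 x -> dyadic_level (r + r).+1 (v x).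
Proof.
move=> [a ok ->]; have [okp [k okk [pE kE]]] :=
  ancestorP ok (leqnSn r : (r <= (r.+1, a).1)%N).
have [q [okq qr e]] := place_dist_image okp erefl.
have [vE _] := (placement_goodP _ _ _).1 e.
have okqk := dchild_ok okq okk.
rewrite pE dmap_child // /v vE -dmap_child //.
apply: dyadic_level_le (dyadic_level_dmap0 _ okqk).
by move: kE => /= kE; rewrite /dchild /=; lia.
Qed.

(** The point x lies in the image of an interval of level r; that image is a standard interval of
    level at most 2r carrying no label off its left endpoint. *)
Lemma place_dist_supp (x : Q2 R) :
  (g.1 : B) x != 1%g -> dyadic_level (r + r) (\val x).
Proof.
move=> bx; have [a okp [y yE]] := dmap_cover r (V_inv v (\val x)).
have [q [okq qr e]] := place_dist_image okp erefl.
have [vE lE] := (placement_goodP _ _ _).1 e.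
have xE : \val x = dmap q y by rewrite -vE -yE V_invVK.
have y0 : \val y = 0.
  apply/eqP; apply: contraT => /lE; rewrite -xE label_val => b1.
  by rewrite b1 eqxx in bx.
rewrite xE (_ : y = I01_0 R); last exact: val_inj.
exact: dyadic_level_le qr (dyadic_level_dmap0 _ okq).
Qed.

End LevelBound.

(** On intervals of level r both maps are affine onto standard intervals, hence fixed by their
    values at the left endpoint and the midpoint; midpoints account for the level r + 1. *)
Lemma place_dist_fun_inj g h r :
  (place_dist g 1%g <= r)%N -> (place_dist h 1%g <= r)%N ->
  (forall x, dyadic_level r.+1 x ->
    (g.2 : thompsonV R) x = (h.2 : thompsonV R) x) ->
  g.2 = h.2.
Proof.
move=> gr hr gh; apply: thompsonV_inj => x.
have [a ok [y ->]] := dmap_cover r x.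
have [q [okq qr e]] := place_dist_image gr ok erefl.
have [q' [okq' qr' e']] := place_dist_image hr ok erefl.
have [vE _] := (placement_goodP _ _ _).1 e.
have [vE' _] := (placement_goodP _ _ _).1 e'.
rewrite vE vE' (_ : q = q') //; apply: (@dmap_index_inj R) => //;
  rewrite -vE -vE'; apply: gh.
  exact: dyadic_level_le (leqnSn r) (dyadic_level_dmap0 _ ok).
exact: dyadic_level_half ok.
Qed.

Lemma place_dist_finite r (F : set L) : finite_set F ->
  finite_set [set g : W | (place_dist g 1%g <= r)%N /\ forall x, F ((g.1 : B) x)].
Proof.
move=> finF.
have listP n : exists s : seq (I01 R), forall x, dyadic_level n x <-> List.In x s.
  have [s sE] := (finite_seqP _).1 (@dyadic_level_finite R n).
  exists s => x; rewrite sE /=; elim: s {sE} => //= y s IH; rewrite inE.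
  split=> [/predU1P[->|/IH]|[->|/IH ->]]; by [left|right|rewrite eqxx|rewrite orbT].
have [s1 s1P] := listP r.+1; have [s2 s2P] := listP (r + r)%N.
(* The values of v at the points of level r + 1 determine v, and the labels at the points of level
   2r determine b. *)
pose ev (i : I01 R + I01 R) g : I01 R + L :=
  match i with inl x => inl ((g.2 : thompsonV R) x) | inr x =>
    inr (label g.1 x) end.
apply: (@finite_set_evals _ _ _ ev (map inl s1 ++ map inr s2)).
  move=> i /(@List.in_app_or _ (map inl s1))[] /List.in_map_iff[x [<- xs]].
    apply: (@sub_finite_set _ _ (inl @` dyadic_level (r + r).+1)).
      move=> _ [g [gr gF] <-] /=; eexists; last reflexivity.
      by apply: place_dist_value gr _ _; apply/s1P.
    by apply: finite_image; apply: dyadic_level_finite.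
  apply: (@sub_finite_set _ _ (inr @` (F `|` [set 1%g]))).
    move=> _ [g [gr gF] <-] /=; eexists; last reflexivity.
    by rewrite /label; case: insub => [y|] /=; [left|right].
  by apply: finite_image; rewrite finite_setU.
move=> g h [gr gF] [hr hF] e.
rewrite [g]surjective_pairing [h]surjective_pairing; congr pair.
  apply: dsumP => x.
  have [lx|nlx] := pselect (dyadic_level (r + r) (\val x)).
    rewrite -!label_val.
    suff : ev (inr (\val x)) g = ev (inr (\val x)) h by case.
    by apply: e; apply: List.in_or_app; right; apply: List.in_map; apply/s2P.
  have -> : (g.1 : B) x = 1%g by apply/eqP; apply: contraT => /(place_dist_supp gr).
  by apply/esym/eqP; apply: contraT => /(place_dist_supp hr).
apply: place_dist_fun_inj gr hr _ => x lx.
suff : ev (inl x) g = ev (inl x) h by case.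
by apply: e; apply: List.in_or_app; left; apply: List.in_map; apply/s1P.
Qed.

Definition supp_prod phi b : R[i] := \prod_(x <- finsupp b) phi (b x).

Section SuppProd.
Variable phi : L -> R[i].
Hypothesis phi1 : phi 1%g = 1.

Lemma supp_prodE b (S : {fset Q2 R}) : (finsupp b `<=` S)%fset ->
  supp_prod phi b = \prod_(x <- S) phi (b x).
Proof. by move=> bS; apply: big_fset_incl => // x _ /dsum_out ->. Qed.

(** With the identity automorphism, [twist] only permutes the points. This removes the action of V
    from the first component of g_i^-1 g_j. *)
Lemma supp_prod_twist v b : supp_prod phi (twist (id_aut L) v b) = supp_prod phi b.
Proof.
pose S := [fset V_Q2 v y | y in finsupp b]%fset.
rewrite (@supp_prodE _ S); last first.
  apply/fsubsetP => x xS; apply: contraLR xS => xS; rewrite memNfinsupp.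
  rewrite -[fun_of_fsfun _ _]/(twist (id_aut L) v b x) twistE id_aut_pow.
  rewrite dsum_out //; apply: contra xS => xS; apply/imfsetP.
  by exists (V_Q2 v^-1%g x) => //=; rewrite -V_Q2_M mulgV V_Q2_1.
rewrite big_imfset /=; last first.
  by move=> x y _ _ e; rewrite -[x]V_Q2_1 -[y]V_Q2_1 -(mulVg v) !V_Q2_M e.
apply: eq_bigr => y _; rewrite twistE id_aut_pow -V_Q2_M.
by rewrite mulVg V_Q2_1.
Qed.

Lemma psd_supp_prod n (b : 'I_n -> B) : positive_definite phi ->
  psd (fun i j => supp_prod phi ((b i)^-1 * b j)%g).
Proof.
move=> /positive_definite_psd pd.
pose S := (\big[fsetU/fset0]_(i < n) finsupp (b i : {fsfun Q2 R -> L with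
  1%g}))%fset.
have bS i x : x \notin S -> b i x = 1%g.
  move=> xS; apply: dsum_out; apply: contra xS => xi.
  by apply/bigfcupP; exists i => //; rewrite mem_index_enum.
apply: (@psd_ext _ _ (fun i j => \prod_(x <- S) phi ((b i x)^-1 * b j x)%g)).
  move=> i j; rewrite (@supp_prodE _ S).
    by apply: eq_bigr => x _; rewrite dsum_divE.
  apply/fsubsetP => x; apply: contraLR => xS; rewrite memNfinsupp.
  have h : dsum_fun ((b i)^-1 * b j)%g x = 1%g.
    rewrite dsum_divE; transitivity (1^-1 * 1 : L)%g; last exact: mulVg.
    by congr (_^-1 * _)%g; apply: bS.
  exact/eqP.
by apply: psd_prod => x; apply: pd.
Qed.

Lemma supp_prod1 : supp_prod phi 1%g = 1.
Proof.
by rewrite /supp_prod big_seq big1 // => x _; rewrite ds_oneE.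
Qed.

Lemma normc_ge0 (z : R[i]) : 0 <= normc z.
Proof. by case: z => a c; apply: sqrtr_ge0. Qed.

(** All factors other than the one at x have modulus at most 1; x is adjoined to the index set as it
    may lie off the support. *)
Lemma supp_prod_le b x : (forall s, normc (phi s) <= 1) ->
  normc (supp_prod phi b) <= normc (phi (b x)).
Proof.
move=> le1; have le1p (s : seq (Q2 R)) : normc (\prod_(y <- s) phi (b y)) <= 1.
  elim: s => [|y s IH]; first by rewrite big_nil normc1.
  by rewrite big_cons normcM -[leRHS]mulr1; apply: ler_pM; rewrite ?normc_ge0.
rewrite (@supp_prodE _ (x |` finsupp b)%fset) ?fsubsetU1 //.
rewrite (big_fsetD1 x) ?fset1U1 //= normcM -[leRHS]mulr1.
by apply: ler_wpM2l (le1p _); apply: normc_ge0.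
Qed.

End SuppProd.

(** * Positive definite functions on the untwisted wreath product *)

Definition wreath_fun (lam : R) phi g : R[i] :=
  lam%:C%C ^+ place_dist g 1%g * supp_prod phi g.1.

Lemma wreath_fun_pd lam phi : 0 <= lam <= 1 -> phi 1%g = 1 ->
  positive_definite phi -> positive_definite (wreath_fun lam phi).
Proof.
move=> lam01 phi1 pd; apply/positive_definite_psd => n g.
apply: (@psd_ext _ _ (fun i j =>
  lam%:C%C ^+ place_dist (g i) (g j) * supp_prod phi ((g i).1^-1 * (g j).1)%g)).
  move=> i j; rewrite /wreath_fun; congr (_ ^+ _ * _).
    by rewrite -[in RHS](place_dist_M (g i)) mulVKg mulg1 place_distC.
  by rewrite sd_divE /= supp_prod_twist.
apply: psd_mul; last exact: psd_supp_prod.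
by apply: psd_symdiff => // i j; apply: placements_symdiff_finite.
Qed.

(** If the value at (b, v) has modulus at least e, then lam^d >= e bounds d, and every single
    |phi(b(x))| is at least e, which confines the labels to a finite set; [place_dist_finite] then
    applies. *)
Lemma wreath_fun_van lam phi : 0 < lam < 1 -> phi 1%g = 1 ->
  positive_definite phi -> vanishes_at_infinity phi ->
  vanishes_at_infinity (wreath_fun lam phi).
Proof.
move=> /andP[l0 l1] phi1 pd van e e0.
have le1 s : normc (phi s) <= 1 by apply: positive_definite_le1.
have [r rP] : exists r, lam ^+ r < e.
  have : (fun n => lam ^+ n) @ \oo --> (0 : R) by apply: cvg_expr;
    rewrite gtr0_norm.
  move=> /cvgrPdist_lt /(_ _ e0) [r _ /(_ r (leqnn r))] /=.
  by rewrite sub0r normrN => h; exists r; apply: le_lt_trans h; apply: ler_norm.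
pose F := [set s | e%:C%C <= `|phi s|] `|` [set 1%g].
have finF : finite_set F by rewrite finite_setU; split;
  [exact: van|exact: finite_set1].
apply: sub_finite_set (place_dist_finite r finF) => g /=; rewrite norm_gecE => h.
have lam0 := ltW l0; have lam1 := ltW l1.
have nl : normc ((lam%:C%C : R[i]) ^+ place_dist g 1%g) = lam ^+ place_dist g 1%g.
  by rewrite -rmorphXn normc_real ger0_norm // exprn_ge0.
have pl1 : lam ^+ place_dist g 1%g <= 1 by rewrite exprn_ile1.
have pl0 : 0 <= lam ^+ place_dist g 1%g by rewrite exprn_ge0.
move: h; rewrite /wreath_fun normcM nl => h.
have hx x : e <= normc (phi ((g.1 : B) x)).
  apply: le_trans h _; apply: le_trans (supp_prod_le phi1 _ x le1).
  by rewrite ler_piMl ?normc_ge0.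
(* The product is compared with its factor at one dyadic point, here 0. *)
have p1 : normc (supp_prod phi g.1) <= 1.
  have /andP[z0 _] := I01_zero_subproof R.
  have x0 : `[< is_dyadic (\val (I01_0 R)) >].
    by apply: asboolT; exists 0, 0%N; rewrite mul0r.
  exact: le_trans (supp_prod_le phi1 _ (exist _ (I01_0 R) x0 : Q2 R) le1) (le1 _).
split=> [|x]; last by left; rewrite /= norm_gecE.
rewrite leqNgt; apply/negP => lt; move: h; apply/negP; rewrite -ltNge.
apply: le_lt_trans rP; apply: le_trans (_ : lam ^+ place_dist g 1%g * 1 <= _).
  by rewrite ler_wpM2l.
by rewrite mulr1 ler_wiXn2l // ltnW.
Qed.

Lemma normc_mul_sub1 (z w : R[i]) : normc z <= 1 ->
  normc (z * w - 1) <= normc (z - 1) + normc (w - 1).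
Proof.
move=> z1; have -> : z * w - 1 = (z - 1) + z * (w - 1) by ring.
apply: le_trans (le_normcD _ _) _; rewrite lerD2l normcM.
by rewrite ler_piMl ?normc_ge0.
Qed.

Lemma normc_prod_sub1 (I : Type) (s : seq I) (f : I -> R[i]) :
  (forall x, normc (f x) <= 1) ->
  normc (\prod_(x <- s) f x - 1) <= \sum_(x <- s) normc (f x - 1).
Proof.
move=> f1; elim: s => [|x s IH]; first by rewrite !big_nil subrr normc0.
by rewrite !big_cons (le_trans (normc_mul_sub1 _ _)) // lerD2l.
Qed.

Lemma haagerup_untwisted_wreath : haagerup R L -> haagerup R W.
Proof.
move=> /haagerupP hL; apply/haagerupP => F e e0.
pose supp g := finsupp (g.1 : {fsfun Q2 R -> L with 1%g}).
pose cost g := (place_dist g 1%g + #|` supp g|)%N.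
pose N : R := (\sum_(g <- F) cost g)%N.+1%:R.
have N0 : 0 < N by rewrite ltr0n.
(* With lam = 1 - d and phi within d of 1 on the labels of F, each of the [cost g] factors is off by
   at most d. By [normc_mul_sub1] and [normc_prod_sub1] errors add up, to at most d * N < e. *)
pose d := Num.min (1 / 2) (e / (2 * N)).
have d0 : 0 < d by rewrite lt_min !divr_gt0 // mulr_gt0.
have d2 : d <= 1 / 2 by rewrite ge_min lexx.
have dN : d * N < e.
  apply: (@le_lt_trans _ _ (e / (2 * N) * N)).
    by rewrite ler_pM2r // ge_min lexx orbT.
  by have -> : e / (2 * N) * N = e / 2 by [field; rewrite gt_eqF]; lra.
have [phi [pd van phi1 phiF]] := hL [seq (g.1 : B) x | g <- F, x <- supp g] d d0.
have le1 s : normc (phi s) <= 1 by apply: positive_definite_le1.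
have l01 : 0 < 1 - d < 1 by apply/andP; split; lra.
exists (wreath_fun (1 - d) phi); split.
- by apply: wreath_fun_pd => //; apply/andP; split; lra.
- exact: wreath_fun_van.
- by rewrite /wreath_fun /= supp_prod1 // /place_dist /symdiff setDv setU0
  fset_set0 cardfs0 expr0 mulr1.
- move=> g gF; have nl : normc ((1 - d)%:C%C : R[i]) <= 1.
    by rewrite normc_real ger0_norm; lra.
  have nd : normc ((1 - d)%:C%C - 1 : R[i]) = d.
    by rewrite -[X in _ - X]/(1%:C%C) -rmorphB normc_real -normrN ger0_norm; lra.
  apply: le_lt_trans dN.
  apply: le_trans (normc_mul_sub1 _ _) _.
    rewrite -rmorphXn normc_real ger0_norm ?exprn_ge0 ?exprn_ile1 //; lra.
  apply: (@le_trans _ _ (d * (cost g)%:R)); last first.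
    rewrite ler_pM2l // ler_nat (leq_trans _ (leqnSn _)) //.
    by rewrite (big_rem g) //= leq_addr.
  rewrite natrD mulrDr; apply: lerD.
    have := @normc_prod_sub1 _ (index_enum 'I_(place_dist g 1%g)) (fun=>
      (1 - d)%:C%C) (fun=> nl).
    by rewrite prodr_const sumr_const card_ord nd mulr_natr.
  apply: le_trans (normc_prod_sub1 _ _) _ => //.
  have -> : d * (#|` supp g|)%:R = \sum_(x <- supp g) d.
    by rewrite big_const_seq count_predT iter_addr addr0 mulr_natr.
  rewrite big_seq [leRHS]big_seq; apply: ler_sum => x xs; apply: ltW; apply: phiF.
  by apply/allpairsPdep; exists g, x.
Qed.

End UntwistedWreathHaagerup.

(** * Untwisting *)

Lemma dsum_exists (X : choiceType) (G : groupType) (S : {fset X}) (f : X -> G) :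
  (forall x, x \notin S -> f x = 1%g) -> exists b : dsum X G, forall x, b x = f x.
Proof.
move=> fS; exists ([fsfun x in S => f x] : {fsfun X -> G with 1%g}) => x.
by rewrite /dsum_fun fsfunE; case: ifP => // /negbT /fS ->.
Qed.

Lemma natr_addl (R : archiRealFieldType) (a : nat) (t : R) : 0 <= t ->
  (a%:R + t \is a Num.nat) = (t \is a Num.nat).
Proof. by move=> t0; rewrite !natrEint addr_ge0 // t0 !andbT rpredDl ?natr_int. Qed.

Section Untwisting.
Variable R : realType.
Implicit Types (x y : Q2 R) (v w : thompsonV R) (p q : nat * nat).

Lemma Q2_level x : exists n, `[< dyadic_level n (\val x) >].
Proof.
by have [n h] := (is_dyadicP _).1 (asboolW (valP x)); exists n; apply: asboolT.
Qed.

Definition depth x : nat := ex_minn (Q2_level x).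

Lemma depthP x n : dyadic_level n (\val x) <-> (depth x <= n)%N.
Proof.
rewrite /depth; case: ex_minnP => m /asboolP hm mmin; split=> [h|le].
  by apply: mmin; apply: asboolT.
exact: dyadic_level_le le hm.
Qed.

(** At z = 0 this can fail: the left endpoint of [ditv p] may reduce to a smaller denominator. *)
Lemma depth_dmap x p (z : Q2 R) : dok p -> \val x = dmap p (\val z) ->
  \val (\val z) != 0 -> depth x = (p.1 + depth z)%N.
Proof.
move=> ok xE z0.
have lev n : dyadic_level (p.1 + n) (\val x) <-> dyadic_level n (\val z).
  rewrite !dyadic_levelE xE dmapE // exprD mulrA mulfVK ?pow2_neq0 // mulrDl.
  rewrite -natrX -natrM natr_addl // mulr_ge0 //; by case/andP: (valP (\val z)).
apply/eqP; rewrite eqn_leq; apply/andP; split.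
  by apply/depthP/lev/depthP.
have [le|lt] := leqP (depth x) p.1.
  have /depthP := le; rewrite xE => /(dyadic_level_dmap ok) h.
  by rewrite h eqxx in z0.
have := (depthP x (depth x)).2 (leqnn _).
rewrite -(subnKC (ltnW lt)) => /lev /depthP h.
by rewrite leq_add2l.
Qed.

Lemma log2_deriv_daff p q (v : I01 R -> I01 R) (x : I01 R) :
  daff p q v -> ditv p x -> log2_deriv v x = p.1%:Z - q.1%:Z.
Proof.
move=> vE xi; apply: (@log2_derivE _ _ _ _ ((p.2%:R + 1) / 2 ^+ p.1 - \val x)).
  by rewrite subr_gt0; move: xi; rewrite /ditv /= => /andP[].
move=> y; rewrite addrC subrK => /andP[y1 y2].
have yi : ditv p y.
  by rewrite /ditv /= y2 andbT (le_trans _ y1) //; case/andP: xi.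
rewrite (vE _ xi) (vE _ yi) expfzDr ?pnatr_eq0 // -exprnN -exprnP.
by field; rewrite pow2_neq0.
Qed.

(** The cocycle log2 v', read at the target point, corrected by the coboundary of [depth]. *)
Definition shift v x : int :=
  log2_deriv v (\val (V_Q2 v^-1%g x)) + ((depth x)%:Z - (depth (V_Q2 v^-1%g x))%:Z).

Lemma shift_M v w x : shift (v * w)%g x = shift v x + shift w (V_Q2 v^-1%g x).
Proof.
rewrite /shift invgM V_Q2_M.
rewrite (log2_deriv_comp _ (thompsonVP v) (thompsonVP w)).
rewrite -[w _](V_Q2_val w) -V_Q2_M mulgV V_Q2_1.
set a := log2_deriv _ _; set b := log2_deriv _ _.
by ring.
Qed.

(** Let v map the piece I i onto J i. Off the left endpoint of J i, [depth_dmap] makes the depths of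
    x and v^-1 x differ by the difference of the two levels, which is exactly minus the logarithm of
    the slope. Only the finitely many left endpoints remain. *)
Lemma shift_finite v : exists S : {fset Q2 R}, forall x, x \notin S -> shift v x
  = 0.
Proof.
have /is_thompsonP[_ [T [I [J [[Io Ix Ii] [Jo _ _] vIJ]]]]] := thompsonVP v.
have Jd i : `[< is_dyadic (\val (dmap (J i) (I01_0 R))) >].
  by apply/asboolT/is_dyadicP; exists (J i).1; apply: dyadic_level_dmap0.
pose e i : Q2 R := exist (fun u : I01 R =>
  is_true `[< is_dyadic (\val u) >]) _ (Jd i).
exists [fset e i | i in T]%fset => x xS.
pose y := V_Q2 v^-1%g x.
have xv : \val x = v (\val y) by rewrite -V_Q2_val -V_Q2_M mulgV V_Q2_1.
have [i yi] := Ix (\val y).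
have [z yz] := ditv_dmapP (Io i) yi.
have xz : \val x = dmap (J i) z by rewrite xv yz; apply: daff_dmap.
have z0 : \val z != 0.
  apply: contra xS => /eqP z0; apply/imfsetP; exists i => //=.
  apply: val_inj; rewrite xz; congr dmap; exact: val_inj.
have zd : `[< is_dyadic (\val z) >].
  apply: asboolT; have [a [n aE]] := asboolW (valP y : `[< is_dyadic _ >]).
  exists (a * 2 ^+ (I i).1 - (I i).2%:Z * 2 ^+ n), n.
  have -> : \val z = \val (\val y) * 2 ^+ (I i).1 - (I i).2%:R.
    by rewrite yz dmapE // mulfVK ?pow2_neq0 // addrC addKr.
  rewrite aE rmorphB !rmorphM !rmorphXn /=; field.
  by rewrite pow2_neq0.
pose zQ : Q2 R := exist (fun u : I01 R => is_true `[< is_dyadic (\val u) >]) z zd.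
rewrite /shift -/y (log2_deriv_daff (vIJ i) yi).
rewrite (@depth_dmap x _ zQ (Jo i) xz z0) (@depth_dmap y _ zQ (Io i) yz z0).
by lia.
Qed.

End Untwisting.

(** * The embedding of the twisted wreath product into the untwisted one *)

Section Embedding.
Variables (R : realType) (G : groupType) (theta : group_aut G).
Notation W := (twisted_wreath R theta).
Notation W' := (twisted_wreath R (id_aut (Zext theta))).

Definition ulabel (g : W) (x : Q2 R) : Zext theta :=
  (aut_pow theta (depth x) ((g.1 : dsum (Q2 R) G) x), shift g.2 x).

Lemma ulabel_dsum g : exists b : dsum (Q2 R) (Zext theta), forall x, b x = ulabel
  g x.
Proof.
have [S SP] := shift_finite g.2.
apply: (@dsum_exists _ _ (S `|` finsupp (g.1 : {fsfun Q2 R -> G with 1%g}))%fset)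
  => x.
rewrite in_fsetU negb_or => /andP[/SP xS /dsum_out xf].
by rewrite /ulabel xS xf aut_pow1.
Qed.

Definition untwist (g : W) : W' := (sval (cid (ulabel_dsum g)), g.2).

Lemma untwistE g x : ((untwist g).1 : dsum (Q2 R) (Zext theta)) x = ulabel g x.
Proof. by rewrite /untwist /=; case: cid => b /=. Qed.

(** With y = v^-1 x, the power of theta falling on the label of h is log2 v'(y) + depth x =
    [shift v x] + depth y. So the integer component of [ulabel g x] acts on [ulabel h y] by the
    power that the twist requires. *)
Lemma ulabel_M (g h : W) x :
  ulabel (g * h)%g x = (ulabel g x * ulabel h (V_Q2 g.2^-1%g x))%g.
Proof.
pose y := V_Q2 g.2^-1%g x.
have e : ((g * h)%g.1 : dsum (Q2 R) G) x = ((g.1 : dsum (Q2 R) G) x *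
    aut_pow theta (log2_deriv (g.2 : thompsonV R) (\val y)) ((h.1 : dsum (Q2 R)
      G) y))%g.
  by rewrite -[LHS]/(ds_mul g.1 (twist theta g.2 h.1) x) ds_mulE twistE.
rewrite /ulabel e; congr pair; last exact: shift_M.
rewrite aut_pow_morph; congr (_ * _)%g; rewrite -aut_powD.
transitivity (aut_pow theta (shift g.2 x + (depth y)%:Z) ((h.1 : dsum (Q2 R) G) y)).
  by congr aut_pow; rewrite /shift -/y; ring.
exact: aut_powD.
Qed.

Lemma untwist_M : {morph untwist : g h / (g * h)%g}.
Proof.
move=> g h; rewrite [RHS]sd_mulE; congr pair; apply: dsumP => x.
transitivity (ulabel (g * h)%g x); first exact: untwistE.
rewrite ulabel_M -[RHS]/(ds_mul (untwist g).1
  (twist (id_aut (Zext theta)) g.2 (untwist h).1) x) ds_mulE twistE id_aut_pow.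
by congr (_ * _)%g; apply/esym/untwistE.
Qed.

(** The exponent of theta at x depends on x alone, so it can be undone pointwise. *)
Lemma untwist_inj : injective untwist.
Proof.
move=> g h e; have e2 : g.2 = h.2 := congr1 snd e.
rewrite [g]surjective_pairing [h]surjective_pairing e2; congr pair.
apply: dsumP => x; have := untwistE g x; rewrite e untwistE /ulabel => -[+ _].
by move=> /(congr1 (aut_pow theta (- (depth x)%:Z))); rewrite !aut_powV.
Qed.

End Embedding.

Theorem theorem1 (R : realType) (Gamma : groupType) (theta : group_aut Gamma) :
  haagerup R Gamma -> haagerup R (twisted_wreath R theta).
Proof.
move=> /(haagerup_Zext theta) /haagerup_untwisted_wreath.
exact: haagerup_inj (@untwist_M R Gamma theta) (@untwist_inj R Gamma theta).
Qed.
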